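(* Let $\Delta$ be a partitionable simplicial complex whose face poset is Eulerian. Then (the face poset of) $\Delta$ is $S$-partitionable. In particular, every Eulerian partitionable simplicial complex has a non-negative $\mathbf{cd}$-index, i.e. all coefficients of the $\mathbf{cd}$-index of its face poset are non-negative.
   Context: **Posets.** All posets are finite and graded, with a minimum $\hat 0$ of rank $0$ and a maximum $\hat 1$; ''rank $d+1$'' means $\hat 1$ has rank $d+1$, and coatoms are the elements of rank $d$. A lower set of faces (for instance $\Gamma_\sigma$, $\partial\Gamma_\sigma$, $\partial\overline\sigma$ below) is regarded as such a poset by adjoining a maximum $\hat 1$; in particular $\{\emptyset\}$ denotes the rank-one poset $\{\hat0<\hat1\}$. The face poset of a finite simplicial complex consists of its faces (with $\emptyset$ as $\hat 0$) ordered by inclusion and an adjoined $\hat 1$; the complex is identified with its face poset. For an element $p$, $\overline p=[\hat 0,p]$; for a set $\mathcal C$ of elements, $\overline{\mathcal C}=\bigcup_{p\in\mathcal C}\overline p$; and $\partial\overline\sigma=\overline\sigma\setminus\{\sigma\}$. A poset is Eulerian if every interval $[x,y]$ with $x<y$ has as many elements of even rank as of odd rank. It is near-Eulerian if it is obtained from an Eulerian poset by deleting a single coatom. For a near-Eulerian poset $\Gamma$, its boundary $\partial\Gamma$ is the closure of the set of all $y$ such that $[y,\hat1]$ is a three-element chain, and its semisuspension $\tilde\Sigma\Gamma$ is the Eulerian poset obtained from $\Gamma$ by adjoining a new coatom $\tau$ covering exactly all $y$ such that $[y,\hat 1]$ is a three-element chain. **Partitionable simplicial complexes.** A simplicial complex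 with facets $\sigma_1,\dots,\sigma_t$ is partitionable if its set of faces (including $\emptyset$) can be partitioned into Boolean intervals $[R_i,\sigma_i]=\{F:R_i\subseteq F\subseteq\sigma_i\}$, $i=1,\dots,t$, where $R_i$ is a face contained in $\sigma_i$. **$S$-partitionable posets** (recursive definition). An Eulerian poset $\Omega$ of rank $d+1$ is $S$-partitionable if either $\Omega=\{\emptyset\}$, or $\Omega$ has rank at least $2$ and there is a partition of $\Omega\setminus\{\hat 1\}$ with one class $P_\sigma\subseteq\overline\sigma$ for each coatom $\sigma$ (an $S$-partition) such that, writing $\Gamma_\sigma=\overline{P_\sigma\setminus\{\sigma\}}$: (a) there is a unique initial coatom $\sigma_1$ with $P_{\sigma_1}=\overline{\sigma_1}$, and $P_{\sigma_1}\setminus\{\sigma_1\}=\partial\overline{\sigma_1}$ is $S$-partitionable of rank $d$; (b) there is a unique terminal coatom $\sigma_t$ with $P_{\sigma_t}=\{\sigma_t\}$; (c) for every other coatom $\sigma$ (called ordinary), $\Gamma_\sigma$ is near-Eulerian of rank $d$, $\Gamma_\sigma=(P_\sigma\setminus\{\sigma\})\uplus\partial\Gamma_\sigma$ (disjoint union), and $\tilde\Sigma\Gamma_\sigma$ is $S$-partitionable of rank $d$ via an $S$-partition whose initial coatom is the added coatom $\tau_\sigma$. **$\mathbf{cd}$-index.** For a poset of rank $d+1$ and $K\subseteq[d]$, $f_K$ is the number of chains whose set of ranks is $K$, and $h_K=\sum_{T\subseteq K}(-1)^{|K\setminus T|}f_T$. Let $\mathbf a,\mathbf b$ be non-commuting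 variables and $u_K=u_1\cdots u_d$ with $u_i=\mathbf b$ if $i\in K$, $u_i=\mathbf a$ if $i\notin K$. The $\mathbf{cd}$-index is the unique polynomial in non-commuting variables $\mathbf c,\mathbf d$ such that substituting $\mathbf c=\mathbf a+\mathbf b$, $\mathbf d=\mathbf{ab}+\mathbf{ba}$ gives $\sum_{K\subseteq[d]}h_Ku_K$. It exists for every Eulerian poset (Bayer–Klapper). *)

(* Defs.v *)
From HB Require Import structures.
From mathcomp Require Import all_boot all_order all_algebra.
From mathcomp Require Import monalg.

Set Implicit Arguments.
Unset Strict Implicit.
Unset Printing Implicit Defensive.

Import Order.Theory GRing.Theory Num.Theory.

Local Open Scope order_scope.

(** A poset with maximum is a [finTPOrderType] and its maximum is [\top]; the
existence of a minimum is part of [graded]. *)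

Section PosetNotions.
Context {disp : Order.disp_t} {T : finPOrderType disp}.
Implicit Types (x y z : T) (A C : {set T}).

Definition covers x y := (x < y) && ~~ [exists z, (x < z) && (z < y)].

Definition chain C := [forall x in C, forall y in C, x >=< y].

(** The length of a longest chain ending at [x], i.e. the largest size of a
chain of elements strictly below [x]; on a graded poset this is the rank
function, with value 0 at the minimum. *)
Definition rank x : nat :=
  (\max_(C : {set T} | chain C && (C \subset [set y | (y < x)%O])) #|C|)%N.

Definition order_interval x y : {set T} := [set z | (x <= z) && (z <= y)].

Definition lower_closure A : {set T} := [set x | [exists y in A, x <= y]].

End PosetNotions.

Section TopPosetNotions.
Context {disp : Order.disp_t}.
Implicit Types T : finTPOrderType disp.

Definition poset_rank T : nat := rank (\top : T).

Definition graded T : Prop :=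
  (exists x : T, forall y : T, x <= y) /\
  (forall x y : T, covers x y -> rank y = (rank x).+1).

Definition eulerian T : Prop :=
  graded T /\
  (forall x y : T, x < y ->
     #|[set z in order_interval x y | ~~ odd (rank z)]| =
     #|[set z in order_interval x y | odd (rank z)]|).

Definition coatoms T : {set T} := [set x : T | (rank x).+1 == poset_rank T].

(** [T] is order-isomorphic to [E] deprived of the coatom [t]. *)
Definition near_eulerian T : Prop :=
  graded T /\
  exists (E : finTPOrderType disp) (t : E) (f : T -> E),
    [/\ eulerian E, t \in coatoms E,
        forall x y, (f x <= f y) = (x <= y)
      & f @: [set: T] = [set~ t]].

(** The elements [y] such that [[y, \top]] is a three-element chain. *)
Definition three_chain_bottoms T : {set T} :=
  [set y : T | chain (order_interval y \top) & #|order_interval y \top| == 3].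

Definition boundary T : {set T} := lower_closure (three_chain_bottoms T).

Lemma top_notin_boundary T : (\top : T) \notin boundary T.
Proof.
rewrite inE; apply/existsP => -[y /andP[]]; rewrite inE => /andP[_ /eqP c3].
rewrite le1x => /eqP yE; have iE : order_interval y \top = [set \top].
  by apply/setP => z; rewrite !inE yE le1x lex1 andbT.
by move: c3; rewrite iE cards1.
Qed.

Lemma boundary_down T (x y : T) :
  x <= y -> y \in boundary T -> x \in boundary T.
Proof.
move=> xy; rewrite !inE => /existsP[z /andP[zB yz]].
by apply/existsP; exists z; rewrite zB (le_trans xy yz).
Qed.

End TopPosetNotions.

Definition with_top (T : Type) : Type := option T.

Section WithTop.
Context {disp : Order.disp_t} {T : finPOrderType disp}.

Definition with_top_le (x y : with_top T) : bool :=
  match x, y with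
  | _, None => true
  | None, Some _ => false
  | Some a, Some b => a <= b
  end.

Fact with_top_refl : reflexive with_top_le.
Proof. by case=> //= x; apply: lexx. Qed.

Fact with_top_anti : antisymmetric with_top_le.
Proof. by move=> [x|] [y|] //= /le_anti ->. Qed.

Fact with_top_trans : transitive with_top_le.
Proof. by move=> [y|] [x|] [z|] //=; apply: le_trans. Qed.

HB.instance Definition _ := Finite.copy (with_top T) (option T).
HB.instance Definition _ := Order.Le_isPOrder.Build disp (with_top T)
  with_top_refl with_top_anti with_top_trans.

Fact with_top_lex1 (x : with_top T) : x <= (None : with_top T).
Proof. by case: x. Qed.

HB.instance Definition _ := Order.hasTop.Build disp (with_top T) with_top_lex1.

End WithTop.

Section LowerPoset.
Context {disp : Order.disp_t} {T : finPOrderType disp}.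

Definition subposet (A : {set T}) : predArgType := {x : T | x \in A}.

HB.instance Definition _ (A : {set T}) := SubFinite.on (subposet A).
HB.instance Definition _ (A : {set T}) :=
  [SubChoice_isSubPOrder of subposet A by <: with disp].

(** A lower set [A], regarded as a poset with a new maximum. *)
Definition lower_poset (A : {set T}) : finTPOrderType disp :=
  with_top (subposet A).

(** A set of elements of [lower_poset A] seen back in [T], without the adjoined
maximum. *)
Definition lower_elements (A : {set T}) (B : {set lower_poset A}) : {set T} :=
  [set val x | x : subposet A & (Some x : lower_poset A) \in B].

End LowerPoset.

(** [None] is the added coatom: the elements strictly below it are those of the
boundary, and only [\top] is strictly above it. *)

Definition semisuspension (T : Type) : Type := option T.

Section Semisuspension.
Context {disp : Order.disp_t} {T : finTPOrderType disp}.

Definition semisuspension_le (x y : semisuspension T) : bool :=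
  match x, y with
  | None, None => true
  | None, Some b => b == \top
  | Some a, None => a \in boundary T
  | Some a, Some b => a <= b
  end.

Fact semisuspension_refl : reflexive semisuspension_le.
Proof. by case=> //= x; apply: lexx. Qed.

Fact semisuspension_anti : antisymmetric semisuspension_le.
Proof.
move=> [x|] [y|] //= => [/le_anti -> //|/andP[xB /eqP xE]|/andP[/eqP yE yB]].
  by move: (top_notin_boundary T); rewrite -xE xB.
by move: (top_notin_boundary T); rewrite -yE yB.
Qed.

Fact semisuspension_trans : transitive semisuspension_le.
Proof.
move=> [y|] [x|] [z|] //=.
- exact: le_trans.
- exact: boundary_down.
- by move=> /eqP ->; rewrite le1x.
- by move=> _ /eqP ->; apply: lex1.
Qed.

HB.instance Definition _ := Finite.copy (semisuspension T) (option T).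
HB.instance Definition _ := Order.Le_isPOrder.Build disp (semisuspension T)
  semisuspension_refl semisuspension_anti semisuspension_trans.

Fact semisuspension_lex1 (x : semisuspension T) :
  x <= (Some \top : semisuspension T).
Proof. by case: x => [x|]; [apply: lex1 | apply: eqxx]. Qed.

HB.instance Definition _ :=
  Order.hasTop.Build disp (semisuspension T) semisuspension_lex1.

End Semisuspension.

Section SPartition.
Context {disp : Order.disp_t}.

(** [P s] is the class of the coatom [s]; the values of [P] outside of the
coatoms are irrelevant. *)
Definition coatom_partition (T : finTPOrderType disp) (P : T -> {set T}) : Prop :=
  [/\ {in coatoms T, forall s, P s \subset lower_closure [set s]},
      {in coatoms T &, injective P}
    & partition [set P s | s in coatoms T] [set~ \top]].

(** [via T P s] is meant to say that [P] is an S-partition of [T] with initial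
coatom [s]. The two-element poset is the one with the single face [0]. *)
Definition S_partitionable_by
    (via : forall T : finTPOrderType disp, (T -> {set T}) -> T -> Prop)
    (T : finTPOrderType disp) : Prop :=
  #|T| = 2 \/ exists (P : T -> {set T}) (s : T), via T P s.

(** [is_S_partition d P s1]: [T] is Eulerian of rank [d.+1] and [P] is an
S-partition of [T], with initial coatom [s1]. *)
Fixpoint is_S_partition (d : nat) (T : finTPOrderType disp)
    (P : T -> {set T}) (s1 : T) {struct d} : Prop :=
  match d with
  | 0 => False
  | d'.+1 =>
    [/\ eulerian T /\ poset_rank T = d.+1,
        coatom_partition P,
        unique (fun s => s \in coatoms T /\ P s = lower_closure [set s]) s1,
        (let bd := lower_poset (lower_closure [set s1] :\ s1) in
         poset_rank bd = d /\ S_partitionable_by (@is_S_partition d') bd)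
      & exists2 st : T,
          unique (fun s => s \in coatoms T /\ P s = [set s]) st
        & forall s, s \in coatoms T -> s != s1 -> s != st ->
            let Gamma := lower_closure (P s :\ s) in
            let bdGamma := lower_elements (boundary (lower_poset Gamma)) in
            [/\ near_eulerian (lower_poset Gamma),
                poset_rank (lower_poset Gamma) = d,
                Gamma = (P s :\ s) :|: bdGamma,
                [disjoint P s :\ s & bdGamma]
              & exists Q, @is_S_partition d'
                  (semisuspension (lower_poset Gamma)) Q None]]
  end.

Definition S_partitionable (T : finTPOrderType disp) : Prop :=
  S_partitionable_by (@is_S_partition (poset_rank T).-1) T.

End SPartition.

Local Open Scope ring_scope.

(** Integer polynomials in two non-commuting variables, indexed by [false] and
[true]: [a], [b] in [ab_poly], and [c], [d] in [cd_poly]. *)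
Definition ab_poly := {malg int[{fmonom bool}]}.
Definition cd_poly := {malg int[{fmonom bool}]}.

Definition var_a : ab_poly := << fmu false >>.
Definition var_b : ab_poly := << fmu true >>.

Definition cd_subst (Phi : cd_poly) : ab_poly :=
  mmap (@malgC {fmonom bool} int)
    (fun w : {fmonom bool} => \prod_(l <- (w : seq bool))
       (if l then var_a * var_b + var_b * var_a else var_a + var_b)) Phi.

Section CdIndex.
Context {disp : Order.disp_t} (T : finTPOrderType disp).

Let d := (poset_rank T).-1.

(** [i : 'I_d] stands for the rank [i.+1], so [{set 'I_d}] encodes the subsets
of [{1, ..., d}]. *)
Definition flag_f (K : {set 'I_d}) : nat :=
  #|[set C : {set T} | [&& chain C,
       [forall x in C, exists i in K, rank x == i.+1]
     & [forall i in K, exists x in C, rank x == i.+1]]]|.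

Definition flag_h (K : {set 'I_d}) : int :=
  \sum_(L : {set 'I_d} | L \subset K) (-1) ^+ #|K :\: L| * (flag_f L)%:Z.

Definition ab_index : ab_poly :=
  \sum_(K : {set 'I_d})
    flag_h K *: \prod_(i < d) (if i \in K then var_b else var_a).

Definition is_cd_index : cd_poly -> Prop :=
  unique (fun Phi => cd_subst Phi = ab_index).

End CdIndex.

Import Order.DefaultSetSubsetOrder.

Section Complexes.
Context {V : finType}.
Implicit Types (Delta : {set {set V}}) (F G R : {set V}).

Definition simplicial_complex Delta : Prop :=
  set0 \in Delta /\ (forall F G, F \subset G -> G \in Delta -> F \in Delta).

Definition facets Delta : {set {set V}} :=
  [set F | maxset [pred G | G \in Delta] F].

Definition boolean_interval R F : {set {set V}} :=
  [set G : {set V} | (R \subset G) && (G \subset F)].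

Definition partitionable Delta : Prop :=
  exists R : {set V} -> {set V},
    {in facets Delta, forall F, R F \in Delta /\ R F \subset F} /\
    partition [set boolean_interval (R F) F | F in facets Delta] Delta.

Definition face_poset Delta : finTPOrderType _ :=
  @lower_poset _ {set V} Delta.

End Complexes.

(* Main.v *)
Require Import Defs.
From mathcomp Require Import all_boot all_order all_algebra.
From mathcomp Require Import finmap monalg zify.

(** Why the complex is S-partitionable. Let [Delta] be partitioned into the
intervals [[R_F, F]]. The facet whose interval contains the empty face is initial.
In the signed count of the faces every interval cancels except those with
[R_F = F], and as the total is that of an Eulerian poset, exactly one facet is of
this kind: it is terminal. For any other facet, the class [[R_F, F]] without [F]
consists of the faces of the ball [join_ball R_F F] that are not in its boundary
[join_sphere R_F F]; here the ball is the join of the simplex on [R_F] and the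
boundary of the simplex on [F :\: R_F], and its boundary is the join of the
boundaries of these two simplices. The semisuspension of the ball is not a
simplicial complex, but it is Eulerian, and it is S-partitioned as follows: the
added facet is initial and takes all of its faces; the faces outside its closure
are the unions of [R_F] with a proper subset of [F :\: R_F], and they inherit a
partition of the boundary of the simplex on [F :\: R_F]. The classes thus obtained
are again Boolean intervals in simplices, so the ordinary facets lead to
semisuspensions of the same kind, one dimension lower, while the boundary of an
initial facet is the boundary of a simplex or a join of two of them, again an
Eulerian partitionable complex. The two families, complexes and semisuspensions of
balls, are treated by a simultaneous induction on the rank
([S_partitionable_induction]), whose common step is [is_S_partition_by].

Why the cd-index is non-negative. Let [Psi] be the ab-index of a poset, written as
a sum over its chains, with a letter [b] at every rank of the chain and [a - b] at
the other ranks. Sorting the chains by their maxima, and those by the classes of an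
S-partition, gives [Psi = X(a, b) a + Y(a, b) b], where the contribution of an
ordinary facet [s] to [X] is [p_s - q_s a], [p_s] being the ab-index of the
semisuspension of its class and [q_s] that of the boundary of the class, and the
contribution of the initial facet is the ab-index [q] of its boundary. The ab-index
of an Eulerian poset is symmetric in [a] and [b] ([interval_poly_sym]), so
[Y(a, b) = X(b, a)] because words are independent, and
[Psi - q c = \sum_s ((p_s - q_s c) c + q_s d)] over the ordinary facets
([S_partition_cd_nonneg]). Since the added coatom of a semisuspension is initial in
its S-partition, [p_s - q_s c] is of the same form as the left-hand side in one
dimension less, and induction applies. Finally the substitution of [a + b] and
[ab + ba] for [c] and [d] is injective, so that the polynomial found in this way is
the cd-index. *)

Set Implicit Arguments.
Unset Strict Implicit.
Unset Printing Implicit Defensive.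

Import Order.TTheory GRing.Theory Num.Theory.

Local Open Scope order_scope.

(** * Ranks, coatoms and Eulerian posets *)

Section Rank.
Context {disp : Order.disp_t} {T : finPOrderType disp}.
Implicit Types (x y z : T) (A C : {set T}).

Lemma chainP C :
  reflect {in C &, forall x y, x >=< y} (chain C).
Proof.
apply: (iffP forall_inP) => H.
  by move=> x y xC yC; move/forall_inP: (H x xC); apply.
by move=> x xC; apply/forall_inP => y yC; apply: H.
Qed.

Lemma chain_sub C C' : C \subset C' -> chain C' -> chain C.
Proof.
by move=> /subsetP s /chainP h; apply/chainP => x y /s xC /s yC; apply: h.
Qed.

Lemma chain_add C x : chain C -> C \subset [set y | y < x] -> chain (x |: C).
Proof.
move=> /chainP h /subsetP s; apply/chainP => y z; rewrite !inE.
move=> /orP[/eqP->|yC] /orP[/eqP->|zC]; [exact: comparablexx| | |exact: h].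
  by apply: ge_comparable; move: (s _ zC); rewrite inE => /ltW.
by apply: le_comparable; move: (s _ yC); rewrite inE => /ltW.
Qed.

Lemma chain_max C : chain C -> C != set0 ->
  exists2 x, x \in C & {in C, forall y, y <= x}.
Proof.
move=> /chainP h /set0Pn[x0 x0C].
have [x xC xmax] := @arg_maxnP _ x0 (mem C)
  (fun x => #|[set y in C | y <= x]|) x0C.
exists x => // y yC; have := h _ _ yC xC; rewrite /Order.comparable => /orP[//|xy].
have := xmax y yC; have sub : [set z in C | z <= x] \subset [set z in C | z <= y].
  apply/subsetP => z; rewrite !inE => /andP[-> zx] /=; exact: le_trans xy.
move=> le; have /eqP e : [set z in C | z <= x] == [set z in C | z <= y].
  by rewrite eqEcard sub.
have : y \in [set z in C | z <= x] by rewrite e inE yC lexx.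
by rewrite inE => /andP[].
Qed.

Lemma rank_ge C x : chain C -> C \subset [set y | y < x] -> (#|C| <= rank x)%N.
Proof. by move=> h s; apply: (leq_bigmax_cond (F := fun C : {set T} => #|C|)); rewrite h. Qed.

Lemma rank_witness x :
  exists C, [/\ chain C, C \subset [set y | y < x] & #|C| = rank x].
Proof.
have P0 : chain (set0 : {set T}) && (set0 \subset [set y | y < x]).
  by rewrite sub0set andbT; apply/chainP => y z; rewrite inE.
rewrite /rank (bigop.bigmax_eq_arg set0) //=.
by case: arg_maxnP => // C /andP[h s] _; exists C.
Qed.

Lemma rank_lt x y : x < y -> (rank x < rank y)%N.
Proof.
move=> xy; have [C [h s <-]] := rank_witness x.
have xC : x \notin C by apply/negP => /(subsetP s); rewrite inE ltxx.
rewrite -[(#|C|).+1]add1n.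
have -> : (1 + #|C| = #|x |: C|)%N by rewrite cardsU1 xC.
apply: rank_ge; first exact: chain_add.
apply/subsetP => z; rewrite !inE => /orP[/eqP->//|/(subsetP s)].
by rewrite inE => /lt_trans; apply.
Qed.

Lemma rank_pred x : (0 < rank x)%N ->
  exists2 y, y < x & (rank y).+1 = rank x.
Proof.
have [C [h s e]] := rank_witness x => r0.
have C0 : C != set0 by rewrite -card_gt0 e.
have [y yC ymax] := chain_max h C0.
have yx : y < x by move: (subsetP s _ yC); rewrite inE.
exists y => //; apply/eqP; rewrite eqn_leq rank_lt //= -e (cardsD1 y) yC add1n ltnS.
apply: rank_ge; first by apply: chain_sub h; apply: subsetDl.
by apply/subsetP => z; rewrite !inE => /andP[zy /ymax]; rewrite lt_def eq_sym zy.
Qed.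

(** Strict monotonicity bounds the length of chains from above and the steps down
build a chain of that length. It is stated on a lower set so that the rank can be
identified on a part of a poset, such as the faces below a facet. *)
Lemma rank_unique (A : {set T}) (r : T -> nat) :
    (forall x y, x <= y -> y \in A -> x \in A) ->
    {in A, forall y x, x < y -> (r x < r y)%N} ->
    {in A, forall x, (0 < r x)%N -> exists2 y, y < x & (r y).+1 = r x} ->
  {in A, forall x, rank x = r x}.
Proof.
move=> lowA mono down x xA; apply/eqP; rewrite eqn_leq; apply/andP; split.
  elim: {x}(r x).+1 {-2}x (ltnSn (r x)) xA => // n IH x rx xA.
  have [->//|/rank_pred[y yx <-]] := posnP (rank x).
  have ryx := mono _ xA _ yx.
  apply: leq_ltn_trans (ryx); apply: IH; last exact: lowA (ltW yx) xA.
  by apply: leq_trans ryx _; rewrite -ltnS.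
elim: {x}(r x).+1 {-2}x (ltnSn (r x)) xA => // n IH x rx xA.
have [->//|/(down _ xA)[y yx ry]] := posnP (r x).
rewrite -ry; apply: leq_ltn_trans (rank_lt yx); apply: IH.
  by rewrite -ltnS ry.
exact: lowA (ltW yx) xA.
Qed.

Lemma covers_lt x y : covers x y -> x < y.
Proof. by case/andP. Qed.

Lemma cover_below x y : x < y -> exists2 z, x <= z & covers z y.
Proof.
move=> xy; have P0 : (x <= x) && (x < y) by rewrite lexx.
have [z /andP[xz zy] zmax] := @arg_maxnP _ x [pred z | (x <= z) && (z < y)] rank P0.
exists z => //; rewrite /covers zy /=; apply/existsP => -[w /andP[zw wy]].
have := zmax w; rewrite /= (le_trans xz (ltW zw)) wy => /(_ isT).
by apply/negP; rewrite -ltnNge; apply: rank_lt.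
Qed.

Lemma lower_closureP A x :
  reflect (exists2 y, y \in A & x <= y) (x \in lower_closure A).
Proof. by rewrite inE; apply: exists_inP. Qed.

Lemma lower_closure1 x y : (x \in lower_closure [set y]) = (x <= y).
Proof.
apply/lower_closureP/idP => [[z /set1P->]//|xy]; exists y => //; exact: set11.
Qed.

Lemma lower_closure_down A x y :
  x <= y -> y \in lower_closure A -> x \in lower_closure A.
Proof.
move=> xy /lower_closureP[z zA yz]; apply/lower_closureP; exists z => //.
exact: le_trans yz.
Qed.

End Rank.

Section Graded.
Context {disp : Order.disp_t} {T : finTPOrderType disp}.
Implicit Types x y z : T.

(** A candidate for the rank need only be checked along covering relations: below
any element other than the minimum there is one that it covers. *)
Lemma graded_by (r : T -> nat) (x0 : T) :
    (forall x, x0 <= x) -> r x0 = 0%N ->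
    (forall x y, x < y -> (r x < r y)%N) ->
    (forall x y, covers x y -> r y = (r x).+1) ->
  graded T /\ (forall x, rank x = r x).
Proof.
move=> min0 r0 mono cov; have rE x : rank x = r x.
  apply: (@rank_unique _ _ setT) => //; first by move=> y _ z; apply: mono.
  move=> y _ ry; have [|z _ zy] := @cover_below _ _ x0 y.
    by rewrite lt_def min0 andbT; apply/eqP => e; move: ry; rewrite e r0.
  by exists z; [exact: covers_lt | rewrite (cov _ _ zy)].
by split => //; split => [|x y /cov]; [exists x0 | rewrite !rE].
Qed.

Lemma rank_top_max x : x != \top -> (rank x < poset_rank T)%N.
Proof. by move=> xt; apply: rank_lt; rewrite lt_def lex1 eq_sym xt. Qed.

Lemma coatom_neq_top x : x \in coatoms T -> x != \top.
Proof.
rewrite inE => /eqP e; apply/eqP => xt.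
by move: e; rewrite /poset_rank -xt => /eqP; rewrite gtn_eqF.
Qed.

Lemma coatom_max x y : x \in coatoms T -> x < y -> y = \top.
Proof.
rewrite inE => /eqP e /rank_lt ry; apply/eqP; apply: contraLR ry.
by move=> /rank_top_max; rewrite -leqNgt -e ltnS.
Qed.

Hypothesis gT : graded T.

Lemma coatomP x : reflect (x != \top /\ (forall y, x < y -> y = \top))
                          (x \in coatoms T).
Proof.
apply: (iffP idP) => [xc|[xt xmax]].
  by split; [exact: coatom_neq_top|move=> y; exact: coatom_max].
rewrite inE; apply/eqP; apply: esym; apply: (proj2 gT).
rewrite /covers lt_def lex1 eq_sym xt /=; apply/existsP => -[y /andP[/xmax->]].
by rewrite ltxx.
Qed.

End Graded.

Local Open Scope ring_scope.

Lemma alternating_sum (I : finType) (A : {set I}) (r : I -> nat) :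
  \sum_(z in A) (-1) ^+ r z =
    (#|[set z in A | ~~ odd (r z)]|)%:Z - (#|[set z in A | odd (r z)]|)%:Z :> int.
Proof.
rewrite (bigID (fun z => odd (r z))) /= addrC; congr (_ + _).
  rewrite (eq_bigl (mem [set z in A | ~~ odd (r z)])) => [|z]; last by rewrite !inE.
  rewrite (eq_bigr (fun=> 1)) => [|z]; first by rewrite sumr_const natz.
  by rewrite /= !inE => /andP[_ h]; rewrite -signr_odd (negPf h).
rewrite (eq_bigl (mem [set z in A | odd (r z)])) => [|z]; last by rewrite !inE.
rewrite (eq_bigr (fun=> -1)) => [|z]; first by rewrite sumr_const mulNrn natz.
by rewrite /= !inE => /andP[_ h]; rewrite -signr_odd h.
Qed.

Local Close Scope ring_scope.

Section Eulerian.
Context {disp : Order.disp_t} {T : finTPOrderType disp}.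
Implicit Types x y z : T.
Local Open Scope ring_scope.

(** Signed counts, unlike the two cardinals, can be split along a partition of the
interval and transported to sums over sets of faces. *)
Lemma eulerianP :
  eulerian T <-> graded T /\ forall x y, (x < y)%O ->
      \sum_(z in order_interval x y) (-1) ^+ rank z = 0 :> int.
Proof.
split=> -[gT h]; split => // x y xy; have := h x y xy.
  by rewrite alternating_sum => ->; rewrite subrr.
by rewrite alternating_sum => /eqP; rewrite subr_eq0 eqz_nat => /eqP.
Qed.

End Eulerian.

Section LowerEmbedding.
Context {disp disp' : Order.disp_t}.

(** The rank of an element only depends on what lies below it. Everything that is
compared between a poset, its lower parts and their semisuspensions is compared
through such isomorphisms of lower sets. *)
Lemma rank_lower_embedding (T : finPOrderType disp) (T' : finPOrderType disp')
    (A : {set T}) (f : T -> T') :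
    (forall x y, x <= y -> y \in A -> x \in A) ->
    {in A &, forall x y, (f x <= f y) = (x <= y)} ->
    {in A, forall x y, y <= f x -> exists2 z, z \in A & f z = y} ->
  {in A, forall x, rank (f x) = rank x}.
Proof.
move=> lowA emb sat.
have lt x y : x \in A -> y \in A -> (f x < f y) = (x < y).
  by move=> xA yA; rewrite !lt_leAnge !emb.
move=> x xA; apply: esym.
apply: (@rank_unique _ _ A (fun x => rank (f x))) => //.
  by move=> y yA z zy; apply: rank_lt; rewrite lt // (lowA _ _ (ltW zy)).
move=> y yA /rank_pred[w wy rw].
have [z zA fz] := sat _ yA _ (ltW wy).
by exists z; rewrite -?lt ?fz.
Qed.

Lemma eulerian_lower_embedding (T : finTPOrderType disp) (T' : finTPOrderType disp')
    (f : T -> T') :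
    (forall x y, (f x <= f y) = (x <= y)) ->
    (forall x y, y <= f x -> exists z, f z = y) ->
  eulerian T' -> eulerian T.
Proof.
move=> emb sat /eulerianP[[[b bmin] cov] eul].
have rE x : rank (f x) = rank x.
  apply: (@rank_lower_embedding _ _ setT) => //.
    by move=> y z; rewrite !inE.
  by move=> y _ z /sat[w fw]; exists w; rewrite ?inE.
have inj : injective f.
  by move=> x y e; apply/le_anti; rewrite -!emb e lexx.
have lt x y : (f x < f y) = (x < y) by rewrite !lt_leAnge !emb.
apply/eulerianP; split.
  split=> [|x y /andP[xy nz]].
    have [z fz] := sat _ _ (bmin (f \top)).
    by exists z => y; rewrite -emb fz.
  rewrite -!rE; apply: cov; rewrite /covers lt xy /=.
  apply: contra nz => /existsP[w /andP[xw wy]].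
  have [z fz] := sat _ _ (ltW wy).
  by apply/existsP; exists z; rewrite -!lt fz xw.
move=> x y xy; rewrite -[RHS](eul (f x) (f y)) ?lt //.
have -> : order_interval (f x) (f y) = f @: order_interval x y.
  apply/setP => w; rewrite inE; apply/andP/imsetP => [[xw wy]|[z]].
    have [z fz] := sat _ _ wy; exists z => //.
    by rewrite inE -!emb fz xw.
  by rewrite inE => /andP[xz zy] ->; rewrite !emb.
rewrite big_imset /=; last by move=> ? ? _ _; apply: inj.
by apply: eq_bigr => z _; rewrite rE.
Qed.

End LowerEmbedding.

(** * Balls, spheres and partitionable complexes *)

Section Faces.
Context {V : finType}.
Implicit Types (A B F G R S : {set V}) (D : {set {set V}}).

(** Adding or removing a fixed vertex of [B :\: A] is a sign-reversing involution. *)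
Lemma boolean_sum A B : A \subset B ->
  (\sum_(F in boolean_interval A B) (-1) ^+ #|F| =
     if A == B then (-1) ^+ #|B| else 0 :> int)%R.
Proof.
move=> AB; case: eqP => [<-|/eqP nAB].
  rewrite (big_pred1 A) // => F.
  by rewrite inE /= eqEsubset andbC.
have /properP[_ [v vB vA]] : A \proper B by rewrite properEneq nAB.
(* The sign-reversing involution toggles [v]. *)
pose f F := if v \in F then F :\ v else v |: F.
have fK : involutive f.
  move=> F; rewrite /f; case: (boolP (v \in F)) => vF.
    by rewrite !inE eqxx /= setD1K.
  by rewrite !inE eqxx /= setU1K.
apply/eqP; rewrite -eqNr -sumrN (reindex_inj (inv_inj fK)) /=; apply/eqP.
apply: eq_big => [F|F _].
  rewrite !inE /f; case: ifP => vF.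
    rewrite subsetD1 vA andbT; congr (_ && _); apply/idP/idP => [FB|].
      by rewrite -(setD1K vF) subUset sub1set vB.
    by apply: subset_trans; apply: subsetDl.
  rewrite subUset sub1set vB /=; congr (_ && _).
  apply/idP/idP => [/subsetP s|s]; last by apply: subset_trans s (subsetUr _ _).
  apply/subsetP => w wA; move: (s _ wA); rewrite !inE => /orP[/eqP wv|//].
  by rewrite wv (negPf vA) in wA.
rewrite /f; case: ifP => vF.
  by rewrite [in RHS](cardsD1 v F) vF add1n exprS mulN1r.
by rewrite cardsU1 vF add1n exprS mulN1r opprK.
Qed.

(** The simplex on [F] without the faces containing [F :\: R], which is what
remains of a facet [F] once the class [[R, F]] has been split off: a ball, the
join of the simplex on [R] and the boundary of the simplex on [F :\: R]. *)
Definition join_ball R F : {set {set V}} :=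
  [set G : {set V} | (G \subset F) && ~~ (F :\: R \subset G)].

(** Its boundary sphere, the join of the boundaries of the two simplices. *)
Definition join_sphere R F : {set {set V}} :=
  [set G in join_ball R F | ~~ (R \subset G)].

Lemma join_ballP R F G :
  reflect (G \subset F /\ exists2 v, v \in F & (v \notin R) && (v \notin G))
          (G \in join_ball R F).
Proof.
rewrite inE; apply: (iffP andP) => [[GF /subsetPn[v]]|[GF [v vF /andP[vR vG]]]].
  by rewrite inE => /andP[vR vF] vG; split=> //; exists v => //; rewrite vR.
by split=> //; apply/subsetPn; exists v; rewrite // inE vR.
Qed.

Lemma join_sphereP R F G :
  reflect (G \in join_ball R F /\ exists2 u, u \in R & u \notin G)
          (G \in join_sphere R F).
Proof.
by rewrite [X in reflect _ X]inE; apply: (iffP andP) => -[GB /subsetPn H].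
Qed.

Lemma join_ball_down R F G G' :
  G \subset G' -> G' \in join_ball R F -> G \in join_ball R F.
Proof.
rewrite !inE => GG' /andP[G'F nG']; rewrite (subset_trans GG' G'F) /=.
by apply: contra nG' => h; apply: subset_trans GG'.
Qed.

Lemma join_sphere_down R F G G' :
  G \subset G' -> G' \in join_sphere R F -> G \in join_sphere R F.
Proof.
move=> GG'; rewrite ![_ \in join_sphere _ _]inE => /andP[G'B nG'].
rewrite (join_ball_down GG' G'B) /=.
by apply: contra nG' => h; apply: subset_trans GG'.
Qed.

Lemma join_ball_complex R F : R \proper F -> simplicial_complex (join_ball R F).
Proof.
move=> /properP[_ [v vF vR]]; split; last by move=> G G'; exact: join_ball_down.
by apply/join_ballP; split; [exact: sub0set | exists v; rewrite // inE vR].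
Qed.

Lemma join_sphere_complex R F :
  R != set0 -> R \proper F -> simplicial_complex (join_sphere R F).
Proof.
move=> R0 RF; split; last by move=> G G'; exact: join_sphere_down.
by rewrite inE (proj1 (join_ball_complex RF)) subset0.
Qed.

Section JoinSums.
Variables R F : {set V}.
Hypothesis RF : R \proper F.
Local Open Scope ring_scope.

Let sRF : R \subset F. Proof. exact: proper_sub. Qed.

(** The faces of [F] above [G] form a Boolean interval, and so do those containing
moreover [F :\: R], which the ball excludes: their signed count is nonzero only if
this interval is reduced to [F], that is if [G] contains [R]. *)
Lemma join_ball_sum G : G \in join_ball R F ->
  \sum_(H in join_ball R F | G \subset H) (-1) ^+ #|H| =
    (if R \subset G then - (-1) ^+ #|F| else 0) :> int.
Proof.
rewrite inE => /andP[GF nG].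
have := boolean_sum GF; case: eqP => [GF'|_].
  by move: nG; rewrite GF' subsetDl.
rewrite (bigID (fun H : {set V} => F :\: R \subset H)) /= => /eqP.
have sGF : G :|: (F :\: R) \subset F by rewrite subUset GF subsetDl.
rewrite (eq_bigl (mem (boolean_interval (G :|: (F :\: R)) F))) => [|H]; last first.
  by rewrite /= !inE subUset andbAC.
rewrite (boolean_sum sGF) addrC addr_eq0 => /eqP H; apply: etrans (etrans H _).
  apply: eq_bigl => K; rewrite !inE.
  by case: (K \subset F); case: (G \subset K); rewrite /= ?andbT ?andbF.
suff -> : (G :|: F :\: R == F) = (R \subset G) by case: ifP; rewrite ?oppr0.
apply/eqP/idP => [e|RG].
  apply/subsetP => v vR; have : v \in F by rewrite (subsetP sRF).
  by rewrite -e !inE vR orbF.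
apply/eqP; rewrite eqEsubset sGF; apply/subsetP => v vF; rewrite !inE vF andbT.
by case: (boolP (v \in R)) => [/(subsetP RG)->|]; rewrite ?orbT.
Qed.

(** The faces of the ball above [G] that are not on the sphere are those above
[G :|: R], so that both counts come from the ball. *)
Lemma join_sphere_sum G : G \in join_sphere R F ->
  \sum_(H in join_sphere R F | G \subset H) (-1) ^+ #|H| = (-1) ^+ #|F| :> int.
Proof.
rewrite inE => /andP[GB nRG]; have := join_ball_sum GB; rewrite (negPf nRG).
have GRB : G :|: R \in join_ball R F.
  move/join_ballP: GB => [GF [v vF /andP[vR vG]]]; apply/join_ballP.
  by rewrite subUset GF; split=> //; exists v; rewrite // inE negb_or vR vG.
have := join_ball_sum GRB; rewrite subsetUr => e1.
rewrite (bigID (fun H : {set V} => R \subset H)) /=.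
rewrite (eq_bigl (fun H : {set V} => (H \in join_ball R F) && (G :|: R \subset H))) => [|H]; last first.
  by rewrite subUset -andbA.
rewrite e1 addrC => /eqP; rewrite subr_eq0 => /eqP <-.
by apply: eq_bigl => H; rewrite [H \in join_sphere _ _]inE andbAC.
Qed.

End JoinSums.

Lemma proper_complex F : F != set0 -> simplicial_complex [set G : {set V} | G \proper F].
Proof.
move=> F0; split; first by rewrite inE properEneq sub0set eq_sym F0.
by move=> G H GH; rewrite !inE; apply: sub_proper_trans.
Qed.

Lemma facetP D F :
  reflect (F \in D /\ forall G, G \in D -> F \subset G -> G = F) (F \in facets D).
Proof.
rewrite inE; apply: (iffP maxsetP) => /= -[FD m]; split=> // G.
Qed.

(** The form in which partitions into Boolean intervals are used: every face
chooses its facet. *)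
Definition restriction_partition D (r : {set V} -> {set V}) :=
  {in facets D, forall F, r F \subset F} /\
  {in D, forall G, exists2 F, F \in facets D /\ G \in boolean_interval (r F) F &
     {in facets D, forall F', G \in boolean_interval (r F') F' -> F' = F}}.

Lemma partitionable_restriction D :
  partitionable D -> exists r, restriction_partition D r.
Proof.
move=> [r [rF /and3P[/eqP cov /trivIsetP tri _]]]; exists r; split=> [F /rF[]//|G GD].
have := GD; rewrite -{1}cov => /bigcupP[B /imsetP[F FD ->] GF]; exists F; first by split.
move=> F' F'D GF'.
have own H : H \in facets D -> H \in boolean_interval (r H) H.
  by move=> /rF[_ rH]; rewrite inE rH subxx.
have /eqP e : boolean_interval (r F') F' == boolean_interval (r F) F.
  apply: contraT => ne; have := tri _ _ (imset_f _ F'D) (imset_f _ FD) ne.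
  by move=> /pred0P/(_ G); rewrite /= GF GF'.
apply/eqP; rewrite eqEsubset; apply/andP; split.
  by move: (own _ F'D); rewrite e inE => /andP[].
by move: (own _ FD); rewrite -e inE => /andP[].
Qed.

Lemma restriction_partitionable D r :
  simplicial_complex D -> restriction_partition D r -> partitionable D.
Proof.
move=> [_ lowD] [rF rU]; exists r; split.
  move=> F FD; split; last exact: rF.
  by move/facetP: (FD) => [+ _]; apply: lowD; exact: rF.
apply/and3P; split.
- rewrite eqEsubset; apply/andP; split; apply/subsetP => G.
    move=> /bigcupP[B /imsetP[F /facetP[FD _] ->]]; rewrite inE => /andP[_].
    by move/lowD; apply.
  move=> /rU[F [FD GF] _]; apply/bigcupP; exists (boolean_interval (r F) F) => //.
  exact: imset_f.
- apply/trivIsetP => B B' /imsetP[F FD ->] /imsetP[F' FD' ->] ne.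
  apply/pred0P => G /=; apply/negP => /andP[GF GF'].
  have GD : G \in D.
    move/facetP: (FD) => [+ _]; apply: lowD.
    by move: GF; rewrite inE => /andP[].
  have [H _ uH] := rU G GD.
  by move: ne; rewrite (uH F FD GF) (uH F' FD' GF') eqxx.
- apply/imsetP => -[F FD e].
  have : F \in boolean_interval (r F) F by rewrite inE rF ?subxx.
  by rewrite -e inE.
Qed.

Section JoinOfBoundaries.
(** The join of the boundaries of the simplices on the colour classes of [F]. *)
Variables (c : V -> bool) (F : {set V}).

Definition boundary_join : {set {set V}} :=
  [set G : {set V} | (G \subset F) &&
     [forall v in F, exists w in F, (c w == c v) && (w \notin G)]].

Local Notation idx := enum_rank.

(** The facet of a face [G] omits the first vertex missing from [G] in every
colour class. *)
Definition first_missing_facet (G : {set V}) : {set V} :=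
  [set w in F | (w \in G) ||
     [exists v in F, [&& v \notin G, c v == c w & (idx v < idx w)%N]]].

Definition first_missing_restriction (G : {set V}) : {set V} :=
  [set w in F | [forall v in F, (v \notin G) && (c v == c w) ==> (idx w < idx v)%N]].

Local Notation phi := first_missing_facet.
Local Notation r := first_missing_restriction.

Lemma boundary_joinP G :
  reflect (G \subset F /\
            {in F, forall v, exists2 w, w \in F & c w = c v /\ w \notin G})
          (G \in boundary_join).
Proof.
rewrite inE; apply: (iffP andP) => -[GF H]; split=> //.
  move=> v vF; move/forall_inP/(_ v vF)/exists_inP: H => [w wF /andP[/eqP cw wG]].
  by exists w.
apply/forall_inP => v /H[w wF [cw wG]]; apply/exists_inP; exists w => //.
by rewrite cw eqxx.
Qed.

Lemma subset_phi G : G \subset F -> G \subset phi G.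
Proof. by move=> /subsetP GF; apply/subsetP => v vG; rewrite inE GF ?vG. Qed.

(** The vertex that [phi] drops from the colour class of [w] is the first one
missing there. *)
Lemma first_missing G w : w \in F -> w \notin G ->
  exists2 m, [/\ m \in F, m \notin G, c m = c w & (idx m <= idx w)%N] & m \notin phi G.
Proof.
move=> wF wG.
have P0 : [&& w \in F, w \notin G & c w == c w] by rewrite wF wG eqxx.
have [m /and3P[mF mG /eqP cm] mmin] :=
  @arg_minnP _ w [pred v | [&& v \in F, v \notin G & c v == c w]]
    (fun v => val (idx v)) P0.
exists m; first by split=> //; apply: mmin.
rewrite inE mF (negPf mG) /=; apply/exists_inP => -[v vF /and3P[vG /eqP cv lt]].
by have := mmin v; rewrite /= vF vG cv cm eqxx leqNgt lt => /(_ isT).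
Qed.

Lemma phi_boundary_join G : G \in boundary_join -> phi G \in boundary_join.
Proof.
move=> /boundary_joinP[GF m]; apply/boundary_joinP; split.
  by apply/subsetP => v; rewrite inE => /andP[].
move=> v /m[w wF [cw wG]]; have [u [uF uG cu _] uphi] := first_missing wF wG.
by exists u; rewrite // cu.
Qed.

(** A face containing [phi G] misses in each colour class a vertex that [phi G]
misses too, hence the only one. *)
Lemma phi_max G H : H \in boundary_join -> phi G \subset H -> H = phi G.
Proof.
move=> /boundary_joinP[/subsetP HF m] /subsetP s; apply/eqP.
rewrite eqEsubset; apply/andP; split; apply/subsetP => w; last exact: s.
move=> wH; apply: contraT => wphi.
have [v vF [cv vH]] := m _ (HF _ wH).
have inphi u : u \in F -> u \notin phi G ->
    u \notin G /\ forall u', u' \in F -> u' \notin G -> c u' = c u -> (idx u <= idx u')%N.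
  move=> uF; rewrite inE uF /= negb_or => /andP[uG /exists_inPn nu]; split=> //.
  move=> u' u'F u'G cu'; have := nu u' u'F; rewrite u'G cu' eqxx /= -leqNgt.
  by [].
have [wG wmin] := inphi w (HF _ wH) wphi.
have vphi : v \notin phi G by apply: contra vH => /s.
have [vG vmin] := inphi v vF vphi.
have /val_inj/enum_rank_inj vw : val (idx v) = val (idx w).
  by apply/eqP; rewrite eqn_leq wmin // vmin // HF.
by move: vH; rewrite vw wH.
Qed.

Lemma boundary_join_facet G : G \in facets boundary_join -> phi G = G.
Proof.
move=> /facetP[GD gmax]; apply: gmax; first exact: phi_boundary_join.
by apply: subset_phi; case/boundary_joinP: GD.
Qed.

Lemma r_phi G : r (phi G) \subset G.
Proof.
apply/subsetP => w; rewrite inE => /andP[wF /forall_inP H]; apply: contraT => wG.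
have [m [mF mG cm mw] mphi] := first_missing wF wG.
by have := H m mF; rewrite mphi cm eqxx /= ltnNge mw.
Qed.

(** The restriction of a facet consists, in each colour class, of the vertices
before the missing one; a face between the restriction and the facet therefore has
the same first missing vertices as the facet. *)
Lemma phi_unique G H :
  phi H = H -> r H \subset G -> G \subset H -> phi G = H.
Proof.
move=> eH /subsetP rG /subsetP GH; apply/setP => w; apply/idP/idP => wP.
  apply: contraT => wH.
  have wF : w \in F by move: wP; rewrite inE => /andP[].
  have wG : w \notin G by apply: contra wH => /GH.
  move: wP; rewrite inE wF (negPf wG) /= => /exists_inP[v vF /and3P[vG /eqP cv vw]].
  have [u [uF uH cu uv]] : exists u, [/\ u \in F, u \notin H, c u = c v & (idx u <= idx v)%N].
    case: (boolP (v \in H)) => vH; last by exists v.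
    have : v \notin r H by apply: contra vG => /rG.
    rewrite inE vF /= => /forall_inPn[u uF]; rewrite negb_imply -leqNgt.
    by move=> /andP[/andP[uH /eqP cu] uv]; exists u.
  rewrite -eH inE wF /= in wH; move: wH; rewrite negb_or => /andP[_ /exists_inPn/(_ u uF)].
  by rewrite uH cu cv eqxx /= (leq_ltn_trans uv vw).
have wF : w \in F by move: wP; rewrite -eH inE => /andP[].
rewrite inE wF /=; case: (boolP (w \in G)) => //= wG.
have : w \notin r H by apply: contra wG => /rG.
rewrite inE wF /= => /forall_inPn[v vF]; rewrite negb_imply -leqNgt.
move=> /andP[/andP[vH /eqP cv] vw]; apply/exists_inP; exists v => //.
rewrite cv eqxx /= ltn_neqAle vw andbT; apply/andP; split.
  by apply: contra vH => /GH.
apply: contra vH => /eqP/val_inj/enum_rank_inj ->; exact: wP.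
Qed.

Lemma boundary_join_partition : restriction_partition boundary_join r.
Proof.
split.
  move=> G /facetP[GD gmax]; have /boundary_joinP[GF m] := GD.
  apply/subsetP => w; rewrite inE => /andP[wF /forall_inP H]; apply: contraT => wG.
  by have := H w wF; rewrite wG eqxx /= ltnn.
move=> G GD; have /boundary_joinP[GF m] := GD.
exists (phi G).
  split; last by rewrite inE r_phi subset_phi.
  by apply/facetP; split; [exact: phi_boundary_join|move=> H; exact: phi_max].
move=> H /boundary_join_facet eH; rewrite inE => /andP[rG GH].
by rewrite (phi_unique eH rG GH).
Qed.

End JoinOfBoundaries.

(** With a single colour the join is the boundary of the simplex. *)
Lemma proper_restriction F : F != set0 ->
  exists r, restriction_partition [set G : {set V} | G \proper F] r.
Proof.
move=> /set0Pn[x xF]; exists (first_missing_restriction xpredT F).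
suff -> : [set G : {set V} | G \proper F] = boundary_join xpredT F.
  exact: boundary_join_partition.
apply/setP => G; rewrite inE; apply/idP/boundary_joinP => [/properP[GF [v vF vG]]|[GF m]].
  by split=> // _ _; exists v.
by have [v vF [_ vG]] := m x xF; apply/properP; split=> //; exists v.
Qed.

(** With two colours, [R] and its complement in [F], the join is the sphere. *)
Lemma join_sphere_partitionable R F :
  R != set0 -> R \proper F -> partitionable (join_sphere R F).
Proof.
move=> R0 RF; have cpl := join_sphere_complex R0 RF.
apply: (restriction_partitionable (r := first_missing_restriction (fun v => v \in R) F)) => //.
suff -> : join_sphere R F = boundary_join (fun v => v \in R) F.
  exact: boundary_join_partition.
have /set0Pn[x xR] := R0; have /properP[/subsetP sRF [y yF yR]] := RF.
apply/setP => G; apply/join_sphereP/boundary_joinP.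
  move=> [/join_ballP[GF [v vF /andP[vR vG]]] [u uR uG]]; split=> // w wF.
  case: (boolP (w \in R)) => wR; first by exists u; rewrite ?uR ?sRF.
  by exists v; rewrite ?(negPf vR).
move=> [GF m]; split.
  apply/join_ballP; split=> //; have [v vF [/= cv vG]] := m y yF.
  by exists v => //; rewrite vG cv yR.
have [u uF [/= cu uG]] := m x (sRF _ xR); exists u => //.
by rewrite cu xR.
Qed.

Lemma proper_partitionable F :
  F != set0 -> partitionable [set G : {set V} | G \proper F].
Proof.
move=> F0; have [r] := proper_restriction F0.
exact: restriction_partitionable (proper_complex F0).
Qed.

End Faces.

(** * Posets represented by complexes *)

Section Represents.
Context {disp : Order.disp_t} {V : finType}.

(** The proper part of [L] is the complex [D], through the isomorphism [g]. *)
Definition represents (L : finTPOrderType disp) (g : L -> {set V})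
    (D : {set {set V}}) : Prop :=
  [/\ forall x y, x != \top -> y != \top -> (x <= y) = (g x \subset g y),
      forall x, x != \top -> g x \in D
    & forall G, G \in D -> exists2 x, x != \top & g x = G].

Variables (L : finTPOrderType disp) (g : L -> {set V}) (D : {set {set V}}).
Hypotheses (cD : simplicial_complex D) (rep : represents g D).
Implicit Types x y z : L.

Lemma rep_le x y : x != \top -> y != \top -> (x <= y) = (g x \subset g y).
Proof. by case: rep => + _ _; apply. Qed.

Lemma rep_in x : x != \top -> g x \in D.
Proof. by case: rep => _ + _; apply. Qed.

Lemma rep_ex G : G \in D -> exists2 x, x != \top & g x = G.
Proof. by case: rep => _ _; apply. Qed.

Lemma rep_inj x y : x != \top -> y != \top -> g x = g y -> x = y.
Proof. by move=> xt yt e; apply/le_anti; rewrite !rep_le // e subxx. Qed.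

Lemma rep_lt x y : x != \top -> y != \top -> (x < y) = (g x \proper g y).
Proof.
by move=> xt yt; rewrite lt_leAnge !rep_le // properE.
Qed.

Lemma lt_top x y : x < y -> x != \top.
Proof. by move=> xy; apply/eqP => xt; move: xy; rewrite xt lt_leAnge lex1 andbF. Qed.

Lemma rep_above x G : x != \top -> G \in D -> g x \proper G ->
  exists y, [/\ y != \top, g y = G & x < y].
Proof.
by move=> xt /rep_ex[y yt <-] xG; exists y; rewrite rep_lt.
Qed.

Lemma rep_covers x y : x != \top -> y != \top -> covers x y -> #|g y| = #|g x|.+1.
Proof.
move=> xt yt /andP[xy nz]; move: (xy); rewrite rep_lt // => /properP[sxy [w wy wx]].
suff -> : g y = w |: g x by rewrite cardsU1 wx.
apply: contraNeq nz => ne.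
have wD : w |: g x \in D.
  apply: (proj2 cD) (rep_in yt); by rewrite subUset sub1set wy.
have [|z [zt gz xz]] := rep_above xt wD.
  by rewrite properEneq subsetUr andbT; apply: contraNneq wx => ->; rewrite setU11.
apply/existsP; exists z; rewrite xz rep_lt // gz properEneq eq_sym ne.
by rewrite subUset sub1set wy.
Qed.

(** The second hypothesis expresses purity: a face that is too small to be a facet
can be enlarged, so that the maximum only covers faces with [n.-1] vertices. *)
Lemma rep_graded n :
    (forall G, G \in D -> (#|G| < n)%N) ->
    (forall G, G \in D -> (#|G|.+1 < n)%N -> exists2 w, w \notin G & w |: G \in D) ->
  [/\ graded L, forall x, x != \top -> rank x = #|g x| & poset_rank L = n].
Proof.
move=> bnd ext; have [x0 x0t gx0] := rep_ex (proj1 cD).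
have min0 x : x0 <= x.
  by have [->|xt] := eqVneq x \top; rewrite ?lex1 // rep_le // gx0 sub0set.
have [|x y xy|x y xy|gL rE] := @graded_by _ _
    (fun x => if x == \top then n else #|g x|) x0 min0.
- by rewrite (negPf x0t) gx0 cards0.
- have xt := lt_top xy; rewrite (negPf xt); case: eqVneq => [_|yt].
    exact/bnd/rep_in.
  by apply: proper_card; rewrite -rep_lt.
- have xt := lt_top (covers_lt xy); rewrite (negPf xt).
  case: eqVneq => [yt|yt]; last exact: rep_covers.
  apply/eqP; rewrite eqn_leq (bnd _ (rep_in xt)) andbT leqNgt; apply/negP => lt.
  have [w wx wD] := ext _ (rep_in xt) lt.
  have [|z [zt gz xz]] := rep_above xt wD.
    by rewrite properEneq subsetUr andbT; apply: contraNneq wx => ->; rewrite setU11.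
  case/andP: xy => _ /existsP[]; exists z; rewrite xz yt lt_leAnge lex1 le1x //.
split=> // [x xt|]; first by rewrite rE (negPf xt).
by rewrite /poset_rank rE eqxx.
Qed.

(** Below a face the poset is Boolean, whatever happens near the maximum. *)
Lemma rep_rank x : x != \top -> rank x = #|g x|.
Proof.
move=> xt; apply: (@rank_unique _ _ [set~ \top] (fun x => #|g x|)); last by rewrite !inE.
- move=> y z yz; rewrite !inE; apply: contraNneq => yt.
  by rewrite -le1x -yt.
- move=> y; rewrite !inE => yt z zy; apply: proper_card.
  by rewrite -rep_lt // (lt_top zy).
move=> y; rewrite !inE => yt; rewrite card_gt0 => /set0Pn[w wy].
have wD : g y :\ w \in D by apply: (proj2 cD) (rep_in yt); apply: subsetDl.
have [z zt gz] := rep_ex wD; exists z; last by rewrite gz (cardsD1 w (g y)) wy.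
by rewrite rep_lt // gz properD1.
Qed.

Lemma rep_sum (P : pred {set V}) (f : {set V} -> int) :
  (\sum_(z | (z != \top) && P (g z)) f (g z) = \sum_(G in D | P G) f G)%R.
Proof.
rewrite (eq_bigl (mem [set z | (z != \top) && P (g z)])) => [|z]; last first.
  by rewrite /= inE.
rewrite -(@big_imset _ _ _ _ _ g _ f) /=.
  apply: eq_bigl => G; apply/imsetP/andP => [[z]|[GD PG]].
    by rewrite inE => /andP[zt Pz] ->; split=> //; apply: rep_in.
  by have [z zt gz] := rep_ex GD; exists z; rewrite // inE zt gz.
by move=> x y; rewrite !inE => /andP[xt _] /andP[yt _]; apply: rep_inj.
Qed.

End Represents.

Section Ball.
Context {disp : Order.disp_t} {V : finType}.
Variables (L : finTPOrderType disp) (g : L -> {set V}) (R F : {set V}).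
Hypotheses (R0 : R != set0) (RF : R \proper F) (rep : represents g (join_ball R F)).
Implicit Types x y z : L.

Let sRF : {subset R <= F}. Proof. exact/subsetP/proper_sub. Qed.
Let cD := join_ball_complex RF.

Lemma ball_graded :
  [/\ graded L, forall x, x != \top -> rank x = #|g x| & poset_rank L = #|F|].
Proof.
apply: (rep_graded cD rep) => G /join_ballP[GF [v vF /andP[vR vG]]].
  by apply: proper_card; apply/properP; split=> //; exists v.
move=> lt; have : (0 < #|F :\: (v |: G)|)%N.
  rewrite cardsD (setIidPr _); last by rewrite subUset sub1set vF.
  by rewrite cardsU1 vG subn_gt0.
move=> /card_gt0P[w]; rewrite !inE negb_or => /andP[/andP[wv wG] wF].
exists w => //; apply/join_ballP; split; first by rewrite subUset sub1set wF.
by exists v => //; rewrite vR !inE negb_or eq_sym wv vG.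
Qed.

Lemma ball_facet v : v \in F -> v \notin R -> F :\ v \in join_ball R F.
Proof.
move=> vF vR; apply/join_ballP; split; first exact: subsetDl.
by exists v; rewrite // vR !inE eqxx.
Qed.

(** The boundary of the poset is the boundary sphere: a codimension one face
omitting a vertex of [R] and one of [F :\: R] lies in a single facet of the ball,
and any other one lies in two. *)
Lemma ball_boundary x :
  (x \in boundary L) = (x != \top) && (g x \in join_sphere R F).
Proof.
apply/lower_closureP/andP => [[y]|[xt /join_sphereP[/join_ballP[GF [v vF]]]]].
  rewrite inE => /andP[/chainP ch /eqP c3] xy.
  have yt : y != \top.
    apply: contra_eqN c3 => /eqP->.
    rewrite (_ : order_interval _ _ = [set \top]) ?cards1 //.
    by apply/setP => z; rewrite !inE lex1 le1x andbT.
  have xt : x != \top by apply: contraNneq yt => xt; rewrite -le1x -xt.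
  split=> //; rewrite inE (rep_in rep) //=; apply/negP => Rx.
  have Ry : R \subset g y by apply: subset_trans Rx _; rewrite -(rep_le rep).
  have /join_ballP[yF [v vF /andP[vR vy]]] := rep_in rep yt.
  case: (boolP (F :\ v \subset g y)) => [Fy|/subsetPn[w]].
    suff : order_interval y \top \subset [set y; \top].
      by move=> /subset_leq_card; rewrite c3 cards2; case: (_ != _).
    apply/subsetP => z; rewrite !inE lex1 andbT => yz.
    case: (eqVneq z \top) => [_|zt]; rewrite ?orbT // orbF; apply/eqP.
    apply: (rep_inj rep) => //.
    have /join_ballP[zF [v' v'F /andP[v'R v'z]]] := rep_in rep zt.
    rewrite (rep_le rep) // in yz; apply/eqP; rewrite eqEsubset yz andbT.
    apply: subset_trans (Fy); apply/subsetP => u uz; rewrite !inE (subsetP zF) // andbT.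
    have v'v : v' = v.
      apply: contraNeq v'z => ne; apply: (subsetP yz); apply: (subsetP Fy).
      by rewrite !inE ne.
    by apply: contraNneq v'z => uv; rewrite v'v -uv.
  rewrite !inE => /andP[wv wF] wy; have wR : w \notin R by apply: contra wy; apply/subsetP.
  have [a aT ga] := rep_ex rep (ball_facet vF vR).
  have [b bt gb] := rep_ex rep (ball_facet wF wR).
  have ya : a \in order_interval y \top.
    by rewrite inE lex1 (rep_le rep) // ga subsetD1 yF vy.
  have yb : b \in order_interval y \top.
    by rewrite inE lex1 (rep_le rep) // gb subsetD1 yF wy.
  have := ch _ _ ya yb; rewrite /Order.comparable !(rep_le rep) // ga gb => /orP[] /subsetP.
    by move=> /(_ w); rewrite !inE wv wF eqxx => /(_ isT).
  by move=> /(_ v); rewrite !inE eq_sym wv vF eqxx => /(_ isT).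
move=> /andP[vR vG] [u uR uG]; have uv : u != v by apply: contraNneq vR => <-.
have [|z zt gz] := rep_ex rep (G := F :\ v :\ u).
  by apply: join_ball_down (ball_facet vF vR); apply: subsetDl.
have [y yt gy] := rep_ex rep (ball_facet vF vR).
exists z; last first.
  by rewrite (rep_le rep) // gz !subsetD1 GF vG uG.
have zy : z < y.
  rewrite (rep_lt rep) // gz gy; apply/properP; split; first exact: subsetDl.
  by exists u; rewrite !inE ?eqxx ?uv ?sRF.
have yT : y < \top by rewrite lt_def lex1 eq_sym yt.
rewrite inE; have -> : order_interval z \top = [set z; y; \top].
  apply/setP => w; rewrite !inE lex1 andbT; apply/idP/idP => [zw|]; last first.
    by move=> /orP[/orP[]|] /eqP-> //; exact: ltW.
  case: (eqVneq w \top) => [//|wt]; rewrite ?orbT // orbF.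
  have /join_ballP[wF [v' v'F /andP[v'R v'w]]] := rep_in rep wt.
  rewrite (rep_le rep) // gz in zw.
  have v'v : v' = v.
    apply: contraNeq v'w => ne; apply: (subsetP zw).
    by rewrite !inE ne v'F !andbT; apply: contraNneq v'R => ->.
  rewrite {}v'v in v'w; have wv : g w \subset F :\ v by rewrite subsetD1 wF.
  case: (boolP (u \in g w)) => uw; apply/orP; [right|left]; apply/eqP.
    apply: (rep_inj rep) => //; apply/eqP; rewrite gy eqEsubset wv /=.
    apply/subsetP => t; case: (eqVneq t u) => [-> //|tu tF].
    by apply: (subsetP zw); rewrite in_setD1 tu.
  by apply: (rep_inj rep) => //; apply/eqP; rewrite gz eqEsubset zw andbT subsetD1 wv.
apply/andP; split.
  apply/chainP => a b; rewrite !inE -!orbA.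
  move=> /or3P[]/eqP-> /or3P[]/eqP->; rewrite ?comparablexx //;
    by [apply: le_comparable; rewrite ?ltW // (lt_trans zy yT)
       |apply: ge_comparable; rewrite ?ltW // (lt_trans zy yT)].
by rewrite -setUA cardsU1 cards2 !inE negb_or (lt_eqF zy) (lt_eqF yT) (lt_eqF (lt_trans zy yT)).
Qed.

End Ball.

(** * The semisuspension of a ball *)

Lemma sum_option (I : finType) (P : pred (option I)) (f : option I -> int) :
  (\sum_(z | P z) f z =
     (if P None then f None else 0) + \sum_(x | P (Some x)) f (Some x))%R.
Proof.
rewrite big_mkcond (bigD1 None) //=; congr (_ + _)%R; rewrite -big_mkcondr.
rewrite (reindex_omap Some id) => [|[x|]] //=.
by apply: eq_bigl => x; rewrite eqxx andbT.
Qed.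

Section Semisuspension.
Context {disp : Order.disp_t} {V : finType}.
Variables (L : finTPOrderType disp) (g : L -> {set V}) (R F : {set V}).
Hypotheses (R0 : R != set0) (RF : R \proper F) (rep : represents g (join_ball R F)).

Local Notation S := (semisuspension L).
Local Notation pole := (None : S).
Local Notation face x := (Some x : S).
Local Notation n := #|F|.

Let gL : graded L. Proof. by case: (ball_graded RF rep). Qed.
Let rkL x : x != \top -> rank x = #|g x|.
Proof. by case: (ball_graded RF rep) => _ + _; apply. Qed.
Let rkT : rank (\top : L) = n. Proof. by case: (ball_graded RF rep). Qed.

Lemma semisuspension_leSS (x y : L) : (face x <= face y) = (x <= y).
Proof. by []. Qed.

Lemma semisuspension_leSN (x : L) : (face x <= pole) = (x \in boundary L).
Proof. by []. Qed.

Lemma semisuspension_leNS (x : L) : (pole <= face x) = (x == \top).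
Proof. by []. Qed.

Lemma semisuspension_ltSS (x y : L) : (face x < face y) = (x < y).
Proof. by rewrite !lt_leAnge !semisuspension_leSS. Qed.

Lemma semisuspension_ltSN (x : L) : (face x < pole) = (x \in boundary L).
Proof. by rewrite lt_neqAle. Qed.

Lemma semisuspension_ltNS (x : L) : (pole < face x) = (x == \top).
Proof. by rewrite lt_neqAle. Qed.

(** The added coatom [pole] has the rank of the facets of the ball, one less than
that of the maximum. *)
Definition semisuspension_rank (z : S) : nat :=
  if z is Some x then rank x else n.-1.

Lemma semisuspension_graded :
  graded S /\ forall z : S, rank z = semisuspension_rank z.
Proof.
have [[x0 min0] cov] := gL.
have [v vF vR] : exists2 v, v \in F & v \notin R by case/properP: RF.
have [u0 u0R] := set0Pn _ R0.
have n0 : (0 < n)%N by apply/card_gt0P; exists v.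
have x0B : x0 \in boundary L.
  have [|x xt gx] := rep_ex rep (G := set0); first exact: (join_ball_complex RF).1.
  apply: boundary_down (min0 x) _; rewrite (ball_boundary RF rep) xt gx.
  by rewrite (join_sphere_complex R0 RF).1.
apply: (@graded_by _ _ semisuspension_rank (face x0)) => [[x|]|//||].
- exact: min0.
- exact: x0B.
- case: (posnP (rank x0)) => [//|/rank_pred[y yx _]].
  by move: yx; rewrite (le_gtF (min0 y)).
- move=> [x|] [y|]; rewrite ?semisuspension_ltSS ?semisuspension_ltSN
    ?semisuspension_ltNS ?ltxx //=; first exact: rank_lt.
    rewrite (ball_boundary RF rep) => /andP[xt /join_sphereP[/join_ballP[xF]]].
    move=> [w wF /andP[wR wx]] [u uR ux]; rewrite rkL //.
    have uF : u \in F by apply: (subsetP (proper_sub RF)).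
    have : g x \subset F :\ u :\ w by rewrite !subsetD1 xF ux wx.
    move/subset_leq_card; rewrite (cardsD1 u F) uF (cardsD1 w (F :\ u)) !inE wF.
    have -> : w != u by apply: contraNneq wR => ->.
    by rewrite /=; lia.
  by move=> /eqP->; rewrite rkT prednK.
move=> [x|] [y|]; rewrite /covers ?semisuspension_ltSS ?semisuspension_ltSN
    ?semisuspension_ltNS ?ltxx //=.
- move=> /andP[xy nz]; apply: cov; rewrite /covers xy; apply: contra nz.
  by move=> /existsP[z]; rewrite -!semisuspension_ltSS => h; apply/existsP; exists (face z).
- rewrite (ball_boundary RF rep) => /andP[/andP[xt xS] nz]; rewrite rkL //.
  apply/eqP; apply: contraNT nz => ne.
  have /join_sphereP[/join_ballP[xF [w wF /andP[wR wx]]] [u uR ux]] := xS.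
  have uF : u \in F by apply: (subsetP (proper_sub RF)).
  have wu : w != u by apply: contraNneq wR => ->.
  have : F :\ u :\ w != g x.
    apply: contraNneq ne => <-; rewrite (cardsD1 u F) uF (cardsD1 w (F :\ u)) !inE wF wu.
    by rewrite /=.
  have sx : g x \subset F :\ u :\ w by rewrite !subsetD1 xF ux wx.
  move=> ne'; have /properP[_ [t tF tx]] : g x \proper F :\ u :\ w.
    by rewrite properEneq eq_sym ne'.
  move: tF; rewrite !inE => /and3P[tw tu tF].
  have tS : t |: g x \in join_sphere R F.
    apply/join_sphereP; split; last by exists u; rewrite // !inE negb_or eq_sym tu.
    apply/join_ballP; split; first by rewrite subUset sub1set tF.
    by exists w; rewrite // wR !inE negb_or eq_sym tw.
  have [tB _] := join_sphereP _ _ _ tS.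
  have [|y [yt gy xy]] := rep_above rep xt tB.
    by rewrite properEneq subsetUr andbT; apply: contraNneq tx => ->; rewrite setU11.
  apply/existsP; exists (face y); rewrite semisuspension_ltSS xy semisuspension_ltSN.
  by rewrite (ball_boundary RF rep) yt gy.
by move=> /andP[/eqP-> _]; rewrite rkT prednK.
Qed.

Let rkS (z : S) : rank z = semisuspension_rank z.
Proof. exact: (proj2 semisuspension_graded). Qed.

Lemma semisuspension_poset_rank : poset_rank S = n.
Proof. by rewrite /poset_rank rkS -rkT. Qed.

(** Above a face on the boundary the ball contributes 0, and the added facet cancels
the maximum. Above a face off the boundary, which the added facet does not contain,
the faces of the ball cancel the maximum by themselves. Below the added facet lies
a sphere. *)
Lemma semisuspension_eulerian : eulerian S.
Proof.
apply/eulerianP; split; first exact: (proj1 semisuspension_graded).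
have n0 : (0 < n)%N by apply: leq_ltn_trans (leq0n _) (proper_card RF).
have sgn : ((-1) ^+ n = - (-1) ^+ n.-1 :> int)%R.
  by rewrite -{1}(prednK n0) exprS mulN1r.
have shift (P : pred L) : (\sum_(z | P z) (-1) ^+ rank z =
   (if P \top then (-1) ^+ n else 0) +
   \sum_(z | (z != \top) && P z) (-1) ^+ #|g z| :> int)%R.
  rewrite (bigID (pred1 \top)) /=; congr (_ + _)%R.
    rewrite (eq_bigl (fun z => (z == \top) && P z)) => [|z]; last by rewrite andbC.
    by rewrite big_mkcondr big_pred1_eq rkT.
  apply: eq_big => z; first by rewrite andbC.
  by move=> /andP[_ zt]; rewrite rkL.
move=> [x|] [y|]; rewrite ?semisuspension_ltSS ?semisuspension_ltSN
    ?semisuspension_ltNS ?ltxx // => xy; rewrite sum_option !inE /=.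
- have xt := lt_top xy; rewrite semisuspension_leSN semisuspension_leNS.
  rewrite (eq_bigl (fun z => x <= z <= y)) => [|z]; last by rewrite inE.
  under eq_bigr do rewrite rkS /=.
  rewrite shift lex1 le1x rkS /=.
  have [yt|yt] := eqVneq y \top.
    rewrite yt /= (eq_bigl (fun z => (z != \top) && (g x \subset g z)));
      last by move=> z; have [->//|zt] := eqVneq z \top; rewrite lex1 andbT (rep_le rep).
    rewrite (rep_sum rep (fun G => g x \subset G) (fun G => (-1) ^+ #|G|)%R).
    rewrite (join_ball_sum RF (rep_in rep xt)) (ball_boundary RF rep) xt inE (rep_in rep xt) /=.
    by case: (R \subset g x) => /=; rewrite ?add0r ?subrr // addr0 sgn subrr.
  rewrite andbF !add0r.
  rewrite (eq_bigl (fun z => (z != \top) && (g z \in boolean_interval (g x) (g y)))).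
    rewrite (rep_sum rep (fun G => G \in boolean_interval (g x) (g y)) (fun G => (-1) ^+ #|G|)%R).
    rewrite (eq_bigl (mem (boolean_interval (g x) (g y)))) => [|G].
      rewrite boolean_sum; last by rewrite -(rep_le rep) // ltW.
      by case: eqP => // /(rep_inj rep xt yt) e; rewrite e ltxx in xy.
    rewrite /= andbC; case: (boolP (G \in boolean_interval _ _)) => //=.
    rewrite inE => /andP[_ Gy].
    exact: (proj2 (join_ball_complex RF)) Gy (rep_in rep yt).
  move=> z; have [->|zt] := eqVneq z \top; first by rewrite le1x (negPf yt) andbF.
  by rewrite inE !(rep_le rep).
- rewrite semisuspension_leSN xy lexx /= rkS /=.
  rewrite (eq_bigl (fun z => (x <= z) && (z \in boundary L))) => [|z]; last by rewrite inE.
  under eq_bigr do rewrite rkS /=.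
  rewrite shift (negPf (top_notin_boundary L)) andbF add0r.
  move: (xy); rewrite (ball_boundary RF rep) => /andP[xt xS].
  rewrite (eq_bigl (fun z => (z != \top) && ((g z \in join_sphere R F) && (g x \subset g z)))).
    rewrite (rep_sum rep (fun G => (G \in join_sphere R F) && (g x \subset G)) (fun G => (-1) ^+ #|G|)%R).
    rewrite (eq_bigl (fun G => (G \in join_sphere R F) && (g x \subset G))) => [|G].
      by rewrite (join_sphere_sum RF xS) sgn subrr.
    by rewrite ![G \in join_sphere R F]inE; case: (G \in join_ball R F).
  move=> z; rewrite (ball_boundary RF rep); have [//|zt] := eqVneq z \top.
  by rewrite /= (rep_le rep) // andbC.
- rewrite (eqP xy) semisuspension_leNS eqxx rkS /=.
  rewrite (big_pred1 \top) => [|z]; last by rewrite inE semisuspension_leNS semisuspension_leSS lex1 andbT.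
  by rewrite rkS /= rkT sgn subrr.
Qed.

Lemma ball_near_eulerian : near_eulerian L.
Proof.
split=> //; exists S, pole, (fun x => face x); split.
- exact: semisuspension_eulerian.
- rewrite inE semisuspension_poset_rank rkS /= prednK //.
  exact: leq_ltn_trans (leq0n _) (proper_card RF).
- by [].
- apply/setP => -[x|]; rewrite !inE ?eqxx /=; first by apply/imsetP; exists x.
  by apply/negbTE/imsetP => -[].
Qed.

End Semisuspension.

(** * Classes of a coatom partition *)

Section LowerPosets.
Context {disp : Order.disp_t} {T : finPOrderType disp}.
Variable A : {set T}.
Local Notation L := (lower_poset A).

Lemma lower_elementsP (B : {set L}) (x : T) :
  reflect (exists2 xA : x \in A, (Some (Sub x xA : subposet A) : L) \in B & True)
          (x \in lower_elements B).
Proof.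
apply: (iffP imsetP) => [[u]|[xA xB _]].
  rewrite inE => uB ->; exists (valP u) => //.
  by rewrite (_ : Sub _ _ = u) //; apply: val_inj; rewrite SubK.
by exists (Sub x xA : subposet A); rewrite ?inE ?SubK.
Qed.

End LowerPosets.

Section InitialBoundary.
Context {disp : Order.disp_t} {T : finTPOrderType disp}.
Variable s : T.
Local Notation bd := (lower_poset (lower_closure [set s] :\ s)).

(** The maximum adjoined to the boundary of [s] is sent to [s], which makes the
boundary a lower interval of the poset. *)
Definition facet_boundary_val (x : bd) : T :=
  if x is Some u then val u else s.

Lemma facet_boundary_val_le x y :
  (facet_boundary_val x <= facet_boundary_val y) = (x <= y).
Proof.
have below (u : subposet (lower_closure [set s] :\ s)) : val u < s.
  by have := valP u; rewrite in_setD1 lower_closure1 lt_neqAle.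
case: x y => [u|] [v|]; first by [].
- by rewrite -[RHS]/true; apply: ltW; apply: below.
- by rewrite -[RHS]/false; apply: lt_geF; apply: below.
by rewrite !lexx.
Qed.

Lemma facet_boundary_val_sat x y :
  y <= facet_boundary_val x -> exists z : bd, facet_boundary_val z = y.
Proof.
move=> yx; have ys : y <= s.
  apply: le_trans yx _; rewrite -[X in _ <= X]/(facet_boundary_val None).
  by rewrite facet_boundary_val_le; case: x.
have [->|ne] := eqVneq y s; first by exists None.
have yA : y \in lower_closure [set s] :\ s by rewrite in_setD1 ne lower_closure1.
by exists (Some (Sub y yA)).
Qed.

Lemma facet_boundary_rank x : rank (facet_boundary_val x) = rank x.
Proof.
apply: (@rank_lower_embedding _ _ _ _ setT); rewrite ?inE //.
- by move=> y z; rewrite !inE.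
- by move=> y z _ _; apply: facet_boundary_val_le.
by move=> y _ z /facet_boundary_val_sat[w fw]; exists w; rewrite ?inE.
Qed.

Lemma facet_boundary_poset_rank : poset_rank bd = rank s.
Proof. by rewrite /poset_rank -facet_boundary_rank. Qed.

Lemma facet_boundary_eulerian : eulerian T -> eulerian bd.
Proof.
by apply: eulerian_lower_embedding facet_boundary_val_le facet_boundary_val_sat.
Qed.

End InitialBoundary.

Section Coatoms.
Context {disp : Order.disp_t} {T : finTPOrderType disp}.
Variable P : T -> {set T}.

(** Covering and disjointness of the classes amount to the choice of one coatom for
every proper element, which is how the partitions below are constructed. *)
Lemma coatom_partition_by :
    {in coatoms T, forall s, s \in P s} ->
    {in coatoms T, forall s, P s \subset lower_closure [set s]} ->
    (forall x, x != \top -> exists2 s, s \in coatoms T /\ x \in P s &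
       {in coatoms T, forall s', x \in P s' -> s' = s}) ->
  coatom_partition P.
Proof.
move=> own sub cov.
have injP : {in coatoms T &, injective P}.
  move=> s s' sc s'c e; have [t _ tu] := cov s (coatom_neq_top sc).
  by rewrite (tu s) ?own // (tu s') // -e own.
split=> //; apply/and3P; split.
- rewrite eqEsubset; apply/andP; split; apply/subsetP => x.
    move=> /bigcupP[B /imsetP[s sc ->] /(subsetP (sub _ sc))].
    rewrite lower_closure1 !inE => xs; apply: contraTneq (coatom_neq_top sc) => xt.
    by rewrite negbK -le1x -xt.
  rewrite !inE => /cov[s [sc xs] _]; apply/bigcupP; exists (P s) => //; exact: imset_f.
- apply/trivIsetP => B B' /imsetP[s sc ->] /imsetP[s' s'c ->] ne.
  apply/pred0P => x /=; apply/negP => /andP[xs xs'].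
  have xt : x != \top.
    apply: contraNneq (coatom_neq_top sc) => xt.
    by have /(_ _ xs) := subsetP (sub _ sc); rewrite lower_closure1 -le1x -xt.
  have [t _ tu] := cov x xt.
  by move: ne; rewrite (tu s sc xs) (tu s' s'c xs') eqxx.
apply/imsetP => -[s sc e]; have := own s sc; by rewrite -e inE.
Qed.

Lemma coatom_partition_sum (Z : nmodType) (f : T -> Z) : coatom_partition P ->
  (\sum_(x in [set~ \top]) f x = \sum_(s in coatoms T) \sum_(x in P s) f x)%R.
Proof.
move=> [_ inj part]; rewrite (set_partition_big _ part) /=.
by rewrite big_imset.
Qed.

End Coatoms.

Section SimplexBelow.
Context {disp : Order.disp_t} {V : finType} {T : finTPOrderType disp}.

(** The facet [s] is a simplex, with vertex set [h s]. The condition is local, since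
semisuspensions have one facet that is not a simplex. *)
Definition simplex_below (h : T -> {set V}) (s : T) : Prop :=
  (forall x y, x <= s -> y <= s -> (x <= y) = (h x \subset h y)) /\
  (forall G : {set V}, G \subset h s -> exists2 x, x <= s & h x = G).

Variables (h : T -> {set V}) (s : T) (R : {set V}).
Hypothesis simp : simplex_below h s.

Let hle x y : x <= s -> y <= s -> (x <= y) = (h x \subset h y).
Proof. by case: simp => + _; apply. Qed.
Let hex (G : {set V}) : G \subset h s -> exists2 x, x <= s & h x = G.
Proof. by case: simp => _; apply. Qed.
Let hsub x : x <= s -> h x \subset h s. Proof. by move=> xs; rewrite -(hle xs (lexx s)). Qed.

Lemma simplex_inj x y : x <= s -> y <= s -> h x = h y -> x = y.
Proof. by move=> xs ys e; apply/le_anti; rewrite (hle xs ys) (hle ys xs) e subxx. Qed.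

Lemma simplex_lt x y : x <= s -> y <= s -> (x < y) = (h x \proper h y).
Proof. by move=> xs ys; rewrite lt_leAnge (hle xs ys) (hle ys xs) properE. Qed.

Lemma simplex_rank x : x <= s -> rank x = #|h x|.
Proof.
move=> xs; apply: (@rank_unique _ _ (lower_closure [set s]) (fun x => #|h x|)).
- by move=> y z yz; apply: lower_closure_down.
- move=> y; rewrite lower_closure1 => ys z zy; apply: proper_card.
  by rewrite -simplex_lt // (le_trans (ltW zy)).
- move=> y; rewrite lower_closure1 card_gt0 => ys /set0Pn[w wy].
  have [|z zs hz] := hex (G := h y :\ w).
    exact: subset_trans (subsetDl _ _) (hsub ys).
  exists z; last by rewrite hz [in RHS](cardsD1 w) wy.
  by rewrite simplex_lt // hz properD1.
by rewrite lower_closure1.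
Qed.

Local Notation class := [set x | (x <= s) && (R \subset h x)].

Lemma simplex_class_sum : R \subset h s ->
  (\sum_(x in class) (-1) ^+ rank x = if R == h s then (-1) ^+ rank s else 0 :> int)%R.
Proof.
move=> Rs; rewrite (simplex_rank (lexx s)) -(boolean_sum Rs).
have -> : boolean_interval R (h s) = h @: class.
  apply/setP => G; rewrite inE; apply/andP/imsetP => [[RG /hex[x xs hx]]|[x]].
    by exists x; rewrite // inE xs hx.
  by rewrite inE => /andP[xs Rx] ->; rewrite Rx hsub.
rewrite big_imset /=.
  by apply: eq_bigr => x; rewrite inE => /andP[xs _]; rewrite simplex_rank.
by move=> x y; rewrite !inE => /andP[xs _] /andP[ys _]; apply: simplex_inj.
Qed.

Hypothesis Rs : R \proper h s.
Local Notation Gamma := (lower_closure (class :\ s)).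
Local Notation L := (lower_poset Gamma).

(** A face lies in a proper face of the class exactly when it misses a vertex
outside [R]: that vertex can then be removed from [s]. *)
Lemma ordinary_closure x :
  (x \in Gamma) = (x <= s) && (h x \in join_ball R (h s)).
Proof.
apply/lower_closureP/andP => [[y]|[xs /join_ballP[xF [v vF /andP[vR vx]]]]].
  rewrite !inE => /and3P[ns ys Ry] xy; have xs := le_trans xy ys.
  split=> //; have /properP[_ [v vs vy]] : h y \proper h s.
    by rewrite -simplex_lt // lt_neqAle ns.
  apply/andP; split; first exact: hsub.
  apply/subsetPn; exists v; first by rewrite inE vs andbT; apply: contra vy; apply/subsetP.
  by apply: contra vy; apply/subsetP; rewrite -(hle xs ys).
have [|y ys hy] := hex (G := h s :\ v); first exact: subsetDl.
exists y; last by rewrite (hle xs ys) hy subsetD1 xF vx.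
rewrite !inE ys hy subsetD1 (proper_sub Rs) vR /= andbT.
by apply: contraTneq vF => e; move/setP/(_ v): hy; rewrite e !inE eqxx /= => ->.
Qed.

Definition ordinary_face (x : L) : {set V} :=
  if x is Some u then h (val u) else set0.

Lemma ordinary_represents : represents ordinary_face (join_ball R (h s)).
Proof.
have below (u : subposet Gamma) : val u <= s /\ h (val u) \in join_ball R (h s).
  by have := valP u; rewrite ordinary_closure => /andP.
split=> [[u|] [v|] //= _ _|[u|] //= _|G GB].
- by have [us _] := below u; have [vs _] := below v; rewrite -(hle us vs).
- exact: (below u).2.
have [|x xs hx] := hex (G := G); first by case/join_ballP: GB.
have xG : x \in Gamma by rewrite ordinary_closure xs hx.
by exists (Some (Sub x xG)); rewrite //= SubK.
Qed.

(** The boundary of the ball consists of its faces that do not contain [R], and the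
class of those that do. *)
Lemma ordinary_class :
  let bdGamma := lower_elements (boundary L) in
  Gamma = (class :\ s) :|: bdGamma /\ [disjoint class :\ s & bdGamma].
Proof.
have bdE x : (x \in lower_elements (boundary L)) =
    (x \in Gamma) && ~~ (R \subset h x).
  have rep := ordinary_represents.
  apply/lower_elementsP/andP => [[xG]|[xG nR]].
    rewrite (ball_boundary Rs rep) => /andP[_]; rewrite inE /= => /andP[_ nR] _.
    by split.
  exists xG => //; rewrite (ball_boundary Rs rep) /=; rewrite inE /= nR andbT.
  by move: xG; rewrite ordinary_closure => /andP[].
have clE x : (x \in class :\ s) = (x \in Gamma) && (R \subset h x).
  rewrite ordinary_closure !inE; have [->|ns] := eqVneq x s.
    by rewrite subsetDl !andbF.
  case: (boolP (x <= s)) => //= xs; case: (boolP (R \subset h x)); rewrite ?andbF //= => Rx.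
  rewrite hsub //= andbT; apply/esym; apply/negP => Dx; case/eqP: ns.
  apply: simplex_inj => //; apply/eqP; rewrite eqEsubset hsub //=.
  apply/subsetP => v vs; case: (boolP (v \in R)) => vR; first exact: (subsetP Rx).
  by apply: (subsetP Dx); rewrite inE vR.
split; first by apply/setP => x; rewrite in_setU clE bdE; case: (x \in Gamma); case: (R \subset _).
by apply/pred0P => x /=; rewrite clE bdE; case: (R \subset _); rewrite ?andbF.
Qed.

End SimplexBelow.

(** * S-partitions of Eulerian partitionable complexes *)

Section Induction.
Context {disp : Order.disp_t} {V : finType}.

Definition ball_S_partitionable (d : nat) : Prop :=
  forall (L : finTPOrderType disp) (g : L -> {set V}) (R F : {set V}),
    R != set0 -> R \proper F -> #|F| = d.+1 -> represents g (join_ball R F) ->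
    exists Q, @is_S_partition disp d (semisuspension L) Q None.

Definition complex_S_partitionable (d : nat) : Prop :=
  forall (L : finTPOrderType disp) (g : L -> {set V}) (D : {set {set V}}),
    simplicial_complex D -> partitionable D -> represents g D ->
    eulerian L -> poset_rank L = d.+1 ->
    S_partitionable_by (@is_S_partition disp d) L.

(** The step common to complexes and to semisuspensions of balls: every facet other
than the initial one, [s1], is a simplex and its class is a Boolean interval. *)
Section BooleanClasses.
Variables (d : nat) (T : finTPOrderType disp) (P : T -> {set T}) (s1 : T).
Variables (h : T -> {set V}) (r : T -> {set V}).
Hypotheses (eT : eulerian T) (rT : poset_rank T = d.+2).
Hypotheses (s1c : s1 \in coatoms T) (Ps1 : P s1 = lower_closure [set s1]).
Hypothesis simp : {in coatoms T, forall s, s != s1 ->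
  [/\ simplex_below h s, P s = [set x | (x <= s) && (r s \subset h x)]
    & r s \subset h s]}.
Hypothesis cov : forall x, x != \top -> exists2 s, s \in coatoms T /\ x \in P s &
  {in coatoms T, forall s', x \in P s' -> s' = s}.

Let rank_coatom s : s \in coatoms T -> rank s = d.+1.
Proof. by rewrite inE rT => /eqP[]. Qed.

Let own : {in coatoms T, forall s, s \in P s}.
Proof.
move=> s sc; have [->|ne] := eqVneq s s1; first by rewrite Ps1 lower_closure1.
by have [_ -> rs] := simp sc ne; rewrite inE lexx.
Qed.

Let below : {in coatoms T, forall s, P s \subset lower_closure [set s]}.
Proof.
move=> s sc; have [->|ne] := eqVneq s s1; first by rewrite Ps1.
have [_ -> _] := simp sc ne; apply/subsetP => x.
by rewrite inE lower_closure1 => /andP[].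
Qed.

Let same x s s' : x \in P s -> x \in P s' -> s \in coatoms T -> s' \in coatoms T ->
  s = s'.
Proof.
move=> xs xs' sc s'c; have xt : x != \top.
  apply: contraNneq (coatom_neq_top sc) => xt.
  by have := subsetP (below sc) _ xs; rewrite lower_closure1 -le1x -xt.
by have [t _ tu] := cov xt; rewrite (tu s) // (tu s').
Qed.

Let part : coatom_partition P.
Proof. exact: coatom_partition_by. Qed.

Let r_neq0 s : s \in coatoms T -> s != s1 -> r s != set0.
Proof.
have [[x0 min0] _] := proj1 eT => sc ne; have [_ Ps _] := simp sc ne.
apply: contraNneq ne => r0; apply/eqP; apply: (@same x0) => //.
  by rewrite Ps inE min0 r0 sub0set.
by rewrite Ps1 lower_closure1.
Qed.

(** Only the classes reduced to their facet contribute to the signed count of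
the faces, apart from the initial class, which is an Eulerian interval. As the
total is that of a sphere, there is exactly one of them. *)
Let terminal_count : #|[set s in coatoms T | (s != s1) && (r s == h s)]| = 1%N.
Proof.
have /eulerianP[[[x0 min0] _] eul] := eT.
have lt0 s : (0 < rank s)%N -> x0 < s.
  move=> rs; rewrite lt_neqAle min0 andbT; apply: contraTneq rs => <-.
  rewrite -leqNgt leqn0; apply/eqP; case: (posnP (rank x0)) => // /rank_pred[y].
  by rewrite (le_gtF (min0 y)).
have total := eul x0 \top (lt0 \top _); rewrite -/(poset_rank T) rT in total.
have {total} := total isT.
rewrite (eq_bigl xpredT) => [|x]; last by rewrite inE min0 lex1.
rewrite (bigD1 \top) //= -/(poset_rank T) rT.
rewrite (eq_bigl (mem [set~ \top])) => [|x]; last by rewrite /= !inE.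
rewrite (coatom_partition_sum _ part) (bigD1 s1) //= Ps1.
rewrite (eq_bigl (mem (order_interval x0 s1))) => [|x]; last first.
  by rewrite /= lower_closure1 inE min0.
rewrite (eul x0 s1); last by apply: lt0; rewrite rank_coatom.
rewrite add0r exprS mulN1r addrC => /eqP; rewrite subr_eq0 => /eqP.
rewrite (eq_bigr (fun s => if r s == h s then (-1) ^+ d.+1 else 0)%R) => [|s]; last first.
  move=> /andP[sc ne]; have [sb -> rs] := simp sc ne.
  by rewrite simplex_class_sum // rank_coatom.
rewrite -big_mkcondr /= (eq_bigl (mem [set s in coatoms T | (s != s1) && (r s == h s)])).
  rewrite sumr_const -mulr_natl -[RHS]mul1r => /mulIf; rewrite signr_eq0 => /(_ isT) /eqP.
  by rewrite (eqr_nat _ _ 1) => /eqP.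
by move=> s; rewrite /= !inE andbA.
Qed.

Lemma is_S_partition_by :
    S_partitionable_by (@is_S_partition disp d)
      (lower_poset (lower_closure [set s1] :\ s1)) ->
    ball_S_partitionable d ->
  @is_S_partition disp d.+1 T P s1.
Proof.
move=> bd ball; have [[x0 min0] _] := proj1 eT.
have /eqP/cards1P[st stE] := terminal_count.
have /setIdP[stc /andP[stne /eqP rst]] : st \in [set s in coatoms T | (s != s1) && (r s == h s)].
  by rewrite stE inE.
have Pst : P st = [set st].
  have [sb -> _] := simp stc stne; apply/setP => x; rewrite !inE.
  apply/andP/eqP => [[xs]|->]; last by rewrite lexx rst.
  rewrite rst => stx; apply: (simplex_inj sb) => //; apply/eqP.
  by rewrite eqEsubset stx andbT -(proj1 sb).
have terminal s : s \in coatoms T -> s != s1 -> r s = h s -> s = st.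
  move=> sc ne rs; apply/set1P; rewrite -stE inE sc ne rs eqxx //.
split=> //.
- split=> // s [sc Ps]; apply: (@same x0); rewrite ?Ps1 ?Ps ?lower_closure1 //.
- by split; first by rewrite facet_boundary_poset_rank rank_coatom.
exists st.
  split=> // s [sc Ps]; have [es|ne] := eqVneq s s1.
    have x0s : x0 \in P s by rewrite es Ps1 lower_closure1.
    move: x0s; rewrite Ps inE => /eqP x0s.
    have := rank_coatom sc; rewrite -x0s.
    case: (posnP (rank x0)) => [->//|/rank_pred[y]].
    by rewrite (le_gtF (min0 y)).
  apply: esym; apply: terminal => //; have [sb Ps' rs] := simp sc ne.
  have [x xs hx] := proj2 sb _ rs; have : x \in P s by rewrite Ps' inE xs hx subxx.
  by rewrite Ps inE => /eqP xE; rewrite -hx xE.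
move=> s sc ne nst; have [sb -> rs] := simp sc ne.
have Rs : r s \proper h s.
  by rewrite properEneq rs andbT; apply: contraNneq nst => /terminal->.
have rep := ordinary_represents sb Rs; have R0 := r_neq0 sc ne.
have hs : #|h s| = d.+1 by rewrite -(simplex_rank sb) // rank_coatom.
have [_ _ rkL] := ball_graded Rs rep.
have [GE GD] := ordinary_class sb Rs.
split=> //; first exact: ball_near_eulerian R0 Rs rep.
  by rewrite rkL.
exact: ball R0 Rs hs rep.
Qed.

End BooleanClasses.

Lemma simplex_boundary_represents (T : finTPOrderType disp) (h : T -> {set V}) s :
  simplex_below h s ->
  represents (fun x : lower_poset (lower_closure [set s] :\ s) =>
                if x is Some u then h (val u) else set0)
             [set G : {set V} | G \proper h s].
Proof.
move=> sb; have below (u : subposet (lower_closure [set s] :\ s)) : val u < s.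
  by have := valP u; rewrite in_setD1 lower_closure1 lt_neqAle.
split=> [[u|] [v|] //= _ _|[u|] //= _|G].
- by apply: (proj1 sb); apply: ltW.
- by rewrite inE -(simplex_lt sb (ltW (below u)) (lexx s)) below.
rewrite inE => Gs; have [x xs hx] := proj2 sb _ (proper_sub Gs).
have xA : x \in lower_closure [set s] :\ s.
  by rewrite in_setD1 lower_closure1 xs andbT; apply: contraTneq Gs => <-; rewrite -hx properxx.
by exists (Some (Sub x xA)).
Qed.

Lemma complex_S_partitionable0 : complex_S_partitionable 0.
Proof.
move=> L g D cD _ rep _ rL; left.
have [x0 x0t gx0] := rep_ex rep (proj1 cD).
rewrite -cardsT (_ : [set: L] = [set x0; \top]) ?cards2 ?x0t //.
apply/setP => x; rewrite !inE; have [->|xt] := eqVneq x \top; first by rewrite orbT.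
rewrite orbF; apply/esym/eqP; apply: (rep_inj rep) => //; rewrite gx0.
by apply/eqP; rewrite -cards_eq0 -(rep_rank cD rep) // -leqn0 -ltnS -rL rank_top_max.
Qed.

(** The class of a facet is the given Boolean interval, and the facet whose interval
contains the empty face is initial; its boundary is that of a simplex. *)
Lemma complex_S_partitionableS d :
  complex_S_partitionable d -> ball_S_partitionable d -> complex_S_partitionable d.+1.
Proof.
move=> IHc IHb L g D cD pD rep eL rL; right.
have [r [rF rU]] := partitionable_restriction pD.
have coatomE s : s \in coatoms L = (s != \top) && (g s \in facets D).
  apply/coatomP/andP; first exact: (proj1 eL).
    move=> [st smax]; split=> //; apply/facetP; split; first exact: rep_in rep _ st.
    move=> G GD sG; have [//|ne] := eqVneq G (g s).
    have [|y [yt _ sy]] := rep_above rep st GD; first by rewrite properEneq eq_sym ne.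
    by rewrite (smax _ sy) eqxx in yt.
  move=> [st /facetP[_ gmax]]; split=> // y sy; apply: contraTeq sy => yt.
  rewrite (rep_lt rep) // properE; apply/negP => /andP[sy].
  by rewrite (gmax _ (rep_in rep yt) sy) subxx.
have simp s : s \in coatoms L -> simplex_below g s.
  rewrite coatomE => /andP[st _].
  have ne x : x <= s -> x != \top.
    by move=> xs; apply: contraNneq st => xt; rewrite -le1x -xt.
  split=> [x y xs ys|G Gs]; first by rewrite (rep_le rep) ?ne.
  have [x xt gx] := rep_ex rep (proj2 cD _ _ Gs (rep_in rep st)).
  by exists x; rewrite // (rep_le rep) // gx.
pose P s := [set x | (x <= s) && (r (g s) \subset g x)].
have cov x : x != \top -> exists2 s, s \in coatoms L /\ x \in P s &
    {in coatoms L, forall s', x \in P s' -> s' = s}.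
  move=> xt; have [F [Ff]] := rU _ (rep_in rep xt).
  have [s st gs] := rep_ex rep (proj1 (facetP _ _ Ff)).
  rewrite inE -gs => /andP[rx xs] uF; exists s.
    by rewrite coatomE st gs Ff; split=> //; rewrite inE (rep_le rep) // xs rx.
  move=> s'; rewrite coatomE => /andP[s't s'f]; rewrite inE => /andP[xs' rx'].
  apply: (rep_inj rep) => //; apply: uF => //.
  by rewrite inE rx' -(rep_le rep).
have [x0 x0t gx0] := rep_ex rep (proj1 cD).
have [s1 [s1c x0s1] _] := cov x0 x0t.
have r0 : r (g s1) = set0.
  by move: x0s1; rewrite inE gx0 subset0 => /andP[_ /eqP].
exists P, s1; apply: (is_S_partition_by (h := g) (r := fun s => r (g s))) => //.
- apply/setP => x; rewrite inE lower_closure1 r0 sub0set andbT //.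
- move=> s sc _; split=> //; first exact: simp.
  by apply: rF; move: sc; rewrite coatomE => /andP[].
have rk1 : rank s1 = d.+1 by move: s1c; rewrite inE rL => /eqP[].
have s1t := coatom_neq_top s1c.
have g10 : g s1 != set0 by rewrite -card_gt0 -(rep_rank cD rep) // rk1.
apply: IHc (proper_complex g10) (proper_partitionable g10) _ _ _.
- exact: (simplex_boundary_represents (simp _ s1c)).
- exact: facet_boundary_eulerian.
- by rewrite facet_boundary_poset_rank.
Qed.

Lemma proper_facetP (S B : {set V}) :
  reflect (exists2 v, v \in S & B = S :\ v) (B \in facets [set G : {set V} | G \proper S]).
Proof.
apply: (iffP (facetP _ _)) => [[]|[v vS ->]].
  rewrite inE => /properP[BS [v vS vB]] bmax; exists v => //; apply: esym; apply: bmax.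
    by rewrite inE properD1.
  by rewrite subsetD1 BS.
split=> [|G]; first by rewrite inE properD1.
rewrite inE => /properP[GS [w wS wG]] sG; apply/eqP; rewrite eqEsubset sG andbT.
rewrite subsetD1 GS; apply: contra wG => vG.
by have [->|wv] := eqVneq w v; rewrite // (subsetP sG) // !inE wv.
Qed.

(** The added coatom, written [None], is initial with the join of two boundaries of
simplices as its boundary. The other facets are the sets [F :\ v] with [v] outside
[R]; they correspond to the facets [S :\ v] of the boundary of the simplex on
[S = F :\: R], whose partition is joined with [R] to define their classes. *)
Lemma ball_S_partitionableS d :
  complex_S_partitionable d -> ball_S_partitionable d -> ball_S_partitionable d.+1.
Proof.
move=> IHc IHb L g R F R0 RF cF rep.
pose S := F :\: R; have S0 : S != set0.
  by have /properP[_ [v vF vR]] := RF; apply/set0Pn; exists v; rewrite inE vR.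
have sRF := proper_sub RF.
have [r [rF rU]] := proper_restriction S0.
pose T := semisuspension L.
pose h (z : T) := if z is Some x then g x else set0.
pose r' (z : T) := R :|: r (h z :&: S).
pose P (z : T) : {set T} := if z is Some _ then [set x : T | (x <= z) && (r' z \subset h x)]
  else lower_closure [set z].
have eT := semisuspension_eulerian R0 RF rep.
have rT : poset_rank (T : finTPOrderType disp) = d.+2.
  by rewrite (semisuspension_poset_rank R0 RF rep).
have [_ rkT] := semisuspension_graded R0 RF rep.
have [_ rkL _] := ball_graded RF rep.
have poleC : (None : T) \in coatoms T by rewrite inE rT rkT /= cF.
have SD v : v \in S -> (F :\ v) :&: S = S :\ v.
  by move=> vS; apply/setP => w; rewrite !inE; case: (w \in F); case: (w \in R); rewrite /= ?andbT ?andbF.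
have coatomE x : ((Some x : T) \in coatoms T) =
    (x != \top) && [exists v in S, g x == F :\ v].
  rewrite inE rT rkT /=; apply/idP/andP => [/eqP[rx]|[xt /exists_inP[v vS /eqP gx]]].
    have xt : x != \top.
      by apply/eqP => xt; move: (rkT (Some \top)); rewrite -/(poset_rank T) rT /= -xt rx => /eqP; rewrite gtn_eqF.
    split=> //; have /join_ballP[xF [v vF /andP[vR vx]]] := rep_in rep xt.
    apply/exists_inP; exists v; first by rewrite inE vR.
    rewrite eqEcard subsetD1 xF vx /= -rkL // rx -ltnS -cF.
    by rewrite [X in (_ <= X)%N](cardsD1 v) vF.
  have vF : v \in F by move: vS; rewrite inE => /andP[].
  by rewrite rkL // gx -cF [X in _ == X](cardsD1 v) vF.
have simp x : (Some x : T) \in coatoms T -> simplex_below h (Some x : T).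
  rewrite coatomE => /andP[xt _].
  have ne (y : L) : y <= x -> y != \top.
    by move=> yx; apply: contraNneq xt => yt; rewrite -le1x -yt.
  split=> [[y|] [z|]|G Gx]; rewrite ?semisuspension_leNS ?(negPf xt) //.
    by move=> yx zx; rewrite [LHS](rep_le rep) ?ne.
  have [y yt gy] := rep_ex rep (join_ball_down Gx (rep_in rep xt)).
  by exists (Some y) => //; rewrite semisuspension_leSS (rep_le rep) // gy.
have cov z : z != \top -> exists2 s, s \in coatoms T /\ z \in P s &
    {in coatoms T, forall s', z \in P s' -> s' = s}.
  case: z => [y|] zt; last first.
    exists None; first by rewrite poleC /= lower_closure1.
    move=> [x|] //; rewrite coatomE => /andP[xt _].
    by rewrite inE semisuspension_leNS (negPf xt).
  have yt : y != \top by [].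
  case: (boolP (y \in boundary L)) => yB.
    exists None; first by rewrite poleC /= lower_closure1.
    move=> [x|] // _; rewrite inE subUset => /andP[_ /andP[Ry _]].
    by move: yB; rewrite (ball_boundary RF rep) yt inE Ry andbF.
  have Ry : R \subset g y.
    by move: yB; rewrite (ball_boundary RF rep) yt inE (rep_in rep yt) /= negbK.
  have /join_ballP[yF [v0 v0F /andP[v0R v0y]]] := rep_in rep yt.
  have [|B [Bf]] := rU (g y :&: S).
    rewrite inE; apply/properP; split; first exact: subsetIr.
    by exists v0; rewrite !inE ?v0R // (negPf v0y).
  have /proper_facetP[v vS Bv] := Bf; rewrite inE => /andP[rA AB] uB.
  have /andP[vR vF] : (v \notin R) && (v \in F) by move: vS; rewrite inE.
  have [x xt gx] := rep_ex rep (ball_facet vF vR).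
  have vy : v \notin g y.
    apply/negP => vy; have /subsetP/(_ v) := AB.
    by rewrite Bv !inE vy vR vF eqxx => /(_ isT).
  exists (Some x).
    rewrite coatomE xt; split; first by apply/exists_inP; exists v; rewrite // gx.
    rewrite inE semisuspension_leSS (rep_le rep) // gx subsetD1 yF vy /=.
    by rewrite subUset Ry /= gx SD // -Bv; apply: subset_trans rA (subsetIl _ _).
  move=> [x'|].
    rewrite coatomE => /andP[x't /exists_inP[v' v'S /eqP gx']].
    rewrite inE semisuspension_leSS subUset (rep_le rep) //= gx' SD //.
    rewrite subsetD1 => /andP[/andP[_ v'y] /andP[_ r'y]].
    have e : S :\ v' = B.
      apply: uB; first by apply/proper_facetP; exists v'.
      rewrite inE subsetI r'y subsetD1 subsetIr inE (negPf v'y) /= !andbT.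
      apply: subset_trans (subsetDl S [set v']).
      by apply: rF; apply/proper_facetP; exists v'.
    congr Some; apply: (rep_inj rep) => //; rewrite gx gx'.
    suff -> : v' = v by [].
    move/setP/(_ v'): e; by rewrite Bv !in_setD1 eqxx v'S andbT; case: eqVneq.
  move=> _; rewrite lower_closure1 semisuspension_leSN => h'; by rewrite h' in yB.
exists P; apply: (is_S_partition_by (h := h) (r := r')) => //.
- move=> [x|] // xc _; split=> //; first exact: simp.
  move: (xc); rewrite coatomE => /andP[xt /exists_inP[v vS /eqP gx]].
  rewrite /r' /= gx SD // subUset subsetD1 sRF /=; apply/andP; split.
    by move: vS; rewrite inE => /andP[].
  have Sf : S :\ v \in facets [set G : {set V} | G \proper S].
    by apply/proper_facetP; exists v.
  by apply: subset_trans (rF _ Sf) _; rewrite setSD // subsetDl.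
have none_below (u : subposet (lower_closure [set (None : T)] :\ (None : T))) :
    exists x, [/\ val u = Some x, x != \top & g x \in join_sphere R F].
  have := valP u; case: (val u) => [x|]; rewrite in_setD1 lower_closure1 ?eqxx //=.
  rewrite semisuspension_leSN => xB; exists x.
  by move: xB; rewrite (ball_boundary RF rep) => /andP[].
pose gb (u : lower_poset (lower_closure [set (None : T)] :\ (None : T))) : {set V} :=
  if u is Some u' then h (val u') else set0.
apply: (IHc _ gb _ (join_sphere_complex R0 RF) (join_sphere_partitionable R0 RF)).
- split=> [[u|] [v|] // _ _|[u|] // _|G GS].
  + have [x [ux xt _]] := none_below u; have [y [vy yt _]] := none_below v.
    rewrite -[LHS]/(val u <= val v) /gb ux vy semisuspension_leSS.
    exact: (rep_le rep).
  + by have [x [ux _ gx]] := none_below u; rewrite /gb ux.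
  have [|x xt gx] := rep_ex rep (G := G); first by case/join_sphereP: GS.
  have xA : (Some x : T) \in lower_closure [set (None : T)] :\ (None : T).
    by rewrite in_setD1 lower_closure1 semisuspension_leSN (ball_boundary RF rep) xt gx.
  by exists (Some (Sub (Some x : T) xA)).
- exact: facet_boundary_eulerian.
- by rewrite facet_boundary_poset_rank rkT /= cF.
Qed.

Lemma S_partitionable_induction d :
  complex_S_partitionable d /\ ball_S_partitionable d.
Proof.
elim: d => [|d [IHc IHb]].
  split; first exact: complex_S_partitionable0.
  move=> L g R F R0 /proper_card RF cF; move: RF.
  by rewrite cF ltnS leqn0 cards_eq0 (negPf R0).
split; first exact: complex_S_partitionableS.
exact: ball_S_partitionableS.
Qed.

End Induction.

Lemma face_poset_represents (V : finType) (Delta : {set {set V}}) :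
  represents (fun x : face_poset Delta => if x is Some u then val u else set0) Delta.
Proof.
split=> [[u|] [v|] //= _ _|[u|] //= _|G GD]; last by exists (Some (Sub G GD)).
exact: valP u.
Qed.

Lemma partitionable_S_partitionable (V : finType) (Delta : {set {set V}}) :
    simplicial_complex Delta -> partitionable Delta -> eulerian (face_poset Delta) ->
  S_partitionable (face_poset Delta).
Proof.
move=> cD pD eD.
apply: (proj1 (S_partitionable_induction _) _ _ _ cD pD (face_poset_represents Delta) eD).
rewrite prednK //; have [x xt _] := rep_ex (face_poset_represents Delta) (proj1 cD).
exact: leq_ltn_trans (leq0n _) (rank_top_max xt).
Qed.

(** * Flag polynomials and their symmetry *)

Local Open Scope ring_scope.

Section FlagPolynomial.
Variables (K : nzRingType) (a b : K).

(** The sum, over the chains of [A] with ranks in [{1, ..., n}], of the words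
with [b] at the ranks of the chain and [a - b] elsewhere; the recursion reads
off the last letter. *)
Fixpoint flag_poly {disp : Order.disp_t} (T : finPOrderType disp) (n : nat)
    (A : {set T}) : K :=
  if n is m.+1 then
    flag_poly m A * (a - b) +
      \sum_(z in A | rank z == m.+1) flag_poly m (A :&: [set y | (y < z)%O]) * b
  else 1.

(** The polynomial of the interval from the minimum to [z]: the letters stand for
the ranks strictly between those of the two ends. *)
Definition interval_poly {disp : Order.disp_t} {T : finPOrderType disp} (z : T) : K :=
  flag_poly (rank z).-1 [set y | (y < z)%O].

(** The chains with maximum [z], as words whose length is the rank of [z]; the
minimum gives the empty word. *)
Definition peak_poly {disp : Order.disp_t} {T : finPOrderType disp} (z : T) : K :=
  if rank z == 0%N then 1 else interval_poly z * b.

Lemma peak_poly_min {disp : Order.disp_t} {T : finPOrderType disp} (z : T) :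
  rank z = 0%N -> peak_poly z = 1.
Proof. by move=> rz; rewrite /peak_poly rz. Qed.

Lemma peak_polyE {disp : Order.disp_t} {T : finPOrderType disp} (z : T) :
  (0 < rank z)%N -> peak_poly z = interval_poly z * b.
Proof. by rewrite lt0n => /negPf rz; rewrite /peak_poly rz. Qed.

Section OnePoset.
Context {disp : Order.disp_t} {T : finPOrderType disp} (x0 : T).
Hypothesis min0 : forall x, (x0 <= x)%O.

Lemma rank_eq0 (x : T) : (rank x == 0%N) = (x == x0).
Proof.
apply/eqP/eqP => [rx|->]; last first.
  by case: (posnP (rank x0)) => // /rank_pred[y]; rewrite (le_gtF (min0 y)).
apply/eqP; rewrite eq_le min0 andbT; apply: contraPT rx => nx.
have /rank_lt : (x0 < x)%O by rewrite lt_leAnge min0.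
by case: (rank x).
Qed.

(** The chains are sorted by their maxima, the minimum standing for the empty chain;
the ranks above the maximum contribute the powers of [a - b]. *)
Lemma flag_polyE n (A : {set T}) :
    x0 \in A -> (forall x y : T, (x <= y)%O -> y \in A -> x \in A) ->
  flag_poly n A =
    \sum_(y in A | (rank y <= n)%N) peak_poly y * (a - b) ^+ (n - rank y).
Proof.
move=> x0A lowA; have r0 : rank x0 = 0%N by apply/eqP; rewrite rank_eq0.
elim: n => [|n IH] /=.
  rewrite (big_pred1 x0) => [|y]; last first.
    by rewrite /= leqn0 rank_eq0; case: eqVneq => [->|]; rewrite ?x0A ?andbF.
  by rewrite /peak_poly r0 /= mulr1.
rewrite [RHS](bigID (fun y => rank y == n.+1)) /= [RHS]addrC IH; congr (_ + _).
  rewrite mulr_suml; apply: eq_big => [y|y /andP[_ yn]].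
    by rewrite -andbA; congr (_ && _); lia.
  by rewrite subSn // exprSr mulrA.
apply: eq_big => [y|y /andP[yA /eqP ry]].
  by case: eqP => [->|]; rewrite ?andbF // leqnn !andbT.
rewrite ry subnn expr0 mulr1 /peak_poly /interval_poly ry /=; congr (flag_poly _ _ * _).
apply/setP => w; rewrite !inE; case: (boolP (w < y)%O); rewrite ?andbF // => wy.
by rewrite (lowA _ _ (ltW wy) yA).
Qed.

Lemma interval_polyE (z : T) : (0 < rank z)%N ->
  interval_poly z =
    \sum_(y | (y < z)%O) peak_poly y * (a - b) ^+ ((rank z).-1 - rank y).
Proof.
move=> rz; rewrite /interval_poly flag_polyE.
- apply: eq_bigl => y; rewrite inE; case: (boolP (y < z)%O) => //= /rank_lt.
  by lia.
- by rewrite inE lt_leAnge min0 /=; apply: contraTN rz => zx;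
    rewrite -leqNgt leqn0 rank_eq0 eq_le zx min0.
by move=> x y xy; rewrite !inE; apply: le_lt_trans.
Qed.

End OnePoset.

Section Transfer.
Context {disp disp' : Order.disp_t}.
Variables (T : finPOrderType disp) (T' : finPOrderType disp') (A : {set T}) (f : T -> T').
Hypothesis lowA : forall x y : T, (x <= y)%O -> y \in A -> x \in A.
Hypothesis emb : {in A &, forall x y, (f x <= f y)%O = (x <= y)%O}.
Hypothesis sat : {in A, forall x y, (y <= f x)%O -> exists2 z, z \in A & f z = y}.

Let inj : {in A &, injective f}.
Proof. by move=> x y xA yA e; apply/le_anti; rewrite -!emb // e lexx. Qed.

Let lt x y : x \in A -> y \in A -> (f x < f y)%O = (x < y)%O.
Proof. by move=> xA yA; rewrite !lt_leAnge !emb. Qed.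

Lemma flag_poly_embedding n (B : {set T}) : B \subset A ->
  flag_poly n (f @: B) = flag_poly n B.
Proof.
elim: n B => [//|n IH] B sBA /=; rewrite IH //; congr (_ + _).
have BA := subsetP sBA; rewrite big_mkcondr big_imset /=; last first.
  by move=> x y /BA xA /BA yA; apply: inj.
rewrite [RHS]big_mkcondr; apply: eq_bigr => z zB.
rewrite (rank_lower_embedding lowA emb sat) ?BA //; case: ifP => // _.
rewrite -IH; last by apply: subset_trans (subsetIl _ _) sBA.
congr (flag_poly _ _ * _); apply/setP => w; rewrite in_setI inE.
apply/andP/imsetP => [[/imsetP[x xB ->]]|[x]].
  by rewrite lt ?BA // => xz; exists x; rewrite // !inE xB.
by rewrite !inE => /andP[xB xz] ->; rewrite imset_f // lt ?BA.
Qed.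

Lemma interval_poly_embedding x : x \in A -> interval_poly (f x) = interval_poly x.
Proof.
move=> xA; rewrite /interval_poly (rank_lower_embedding lowA emb sat) //.
have sub : [set y | (y < x)%O] \subset A.
  by apply/subsetP => y; rewrite inE => /ltW/lowA; apply.
rewrite -(flag_poly_embedding _ sub); congr (flag_poly _ _).
apply/setP => w; rewrite inE; apply/idP/imsetP => [wx|[y yx ->]].
  have [y yA fy] := sat xA (ltW wx); exists y; rewrite // inE -lt // fy //.
by have yA := subsetP sub _ yx; rewrite lt //; move: yx; rewrite inE.
Qed.

Lemma peak_poly_embedding x : x \in A -> peak_poly (f x) = peak_poly x.
Proof.
move=> xA; rewrite /peak_poly (rank_lower_embedding lowA emb sat) //.
by rewrite interval_poly_embedding.
Qed.

End Transfer.

End FlagPolynomial.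

Section Symmetry.
Variables (K : nzRingType) (a b : K).
Context {disp : Order.disp_t} {T : finTPOrderType disp}.
Hypothesis eT : eulerian T.

(** All the words on the left are signed powers of [e] of the same degree, so the sum
is a signed count of the open interval. With [e = a - b], the two powers on the
right are what separates [w] from [z] in the words for the letters [a, b] and for
the letters [b, a]. *)
Lemma eulerian_kernel (e : K) (w z : T) : (w < z)%O ->
  \sum_(y | (w < y < z)%O)
     e ^+ ((rank y).-1 - rank w) * e * (- e) ^+ ((rank z).-1 - rank y) =
  e ^+ ((rank z).-1 - rank w) - (- e) ^+ ((rank z).-1 - rank w).
Proof.
move=> wz; set N := ((rank z).-1 - rank w)%N.
have rwz := rank_lt wz.
have parity (y : T) : (rank y < rank z)%N -> (-1) ^+ ((rank z).-1 - rank y) =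
    - ((-1) ^+ rank z * (-1) ^+ rank y) :> K.
  move=> ryz; rewrite -exprD -signr_odd -[in RHS]signr_odd.
  have -> : odd ((rank z).-1 - rank y) = ~~ odd (rank z + rank y) by lia.
  by case: odd; rewrite ?expr1 ?expr0 ?opprK.
rewrite (eq_bigr (fun y => - ((-1) ^+ rank z * (-1) ^+ rank y) * e ^+ N)); last first.
  move=> y /andP[/rank_lt wy /rank_lt yz]; rewrite [(- e) ^+ _]exprNn -(parity _ yz).
  rewrite -signr_odd; case: odd; rewrite ?expr1 ?expr0 ?mul1r ?mulN1r ?mulrN;
    rewrite -exprSr -exprD; congr (- _ ^+ _) || congr (_ ^+ _); rewrite /N; lia.
rewrite -mulr_suml sumrN -mulr_sumr.
have /eulerianP[_ /(_ w z wz)] := eT.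
rewrite (bigD1 w) /=; last by rewrite inE lexx ltW.
rewrite (bigD1 z) /=; last by rewrite inE lexx ltW // gt_eqF.
rewrite (eq_bigl (fun y => (w < y < z)%O)) => [|y]; last first.
  rewrite inE lt_neqAle [(y < z)%O]lt_neqAle eq_sym.
  by case: (w <= y)%O; case: (y <= z)%O; case: (w == y); case: (y == z).
move=> /(congr1 (fun i : int => i%:~R : K)); rewrite !rmorphD rmorph_sum /= !rmorphXn /=.
under eq_bigr do rewrite rmorphXn /=.
rewrite rmorphN1 addrA => /eqP; rewrite addrC addr_eq0 => /eqP ->.
rewrite [(- e) ^+ _]exprNn (parity _ rwz) mulrN opprK mulrDr -!exprD addnn -mul2n exprM sqrrN expr1n expr1n.
by rewrite mulrDl mul1r mulNr opprK addrC.
Qed.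

(** The flag polynomial of an Eulerian interval is invariant under the exchange
of [a] and [b]: expanding it for [(b, a)] and then, inside each summand, for
[(a, b)] gives a double sum over [w < y < z] that the kernel identity
collapses. *)
Lemma interval_poly_sym (z : T) : interval_poly a b z = interval_poly b a z.
Proof.
have [[x0 min0] _] := proj1 eT.
elim: {z}(rank z) {-2}z (leqnn (rank z)) => [|n IH] z.
  by rewrite leqn0 => /eqP rz; rewrite /interval_poly rz.
rewrite leq_eqVlt => /orP[/eqP rz|]; last by rewrite ltnS; apply: IH.
have z0 : (0 < rank z)%N by rewrite rz.
rewrite !(interval_polyE _ _ min0) //; set e := a - b.
have -> : b - a = - e by rewrite opprB.
have peakE (y : T) : (y < z)%O -> peak_poly b a y = peak_poly a b y +
    \sum_(w | (w < y)%O) peak_poly a b w * e ^+ ((rank y).-1 - rank w) * e.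
  move=> /rank_lt; rewrite rz ltnS => yn; have [ry|ry] := posnP (rank y).
    by rewrite !peak_poly_min // big1 ?addr0 // => w /rank_lt; rewrite ry.
  rewrite !peak_polyE // -mulr_suml -(interval_polyE _ _ min0) // -IH //.
  by rewrite -mulrDr addrC subrK.
rewrite [RHS](eq_bigr (fun y => peak_poly a b y * (- e) ^+ ((rank z).-1 - rank y) +
  \sum_(w | (w < y)%O) peak_poly a b w * (e ^+ ((rank y).-1 - rank w) * e *
     (- e) ^+ ((rank z).-1 - rank y)))); last first.
  move=> y yz; rewrite peakE // mulrDl mulr_suml; congr (_ + _).
  by apply: eq_bigr => w _; rewrite !mulrA.
rewrite big_split /=.
rewrite (exchange_big_dep (fun w => (w < z)%O)) /=; last by move=> y w yz /lt_trans; apply.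
rewrite -big_split /=; apply: eq_bigr => w wz; rewrite -mulr_sumr -mulrDr; congr (_ * _).
rewrite (eq_bigl (fun y => (w < y < z)%O)) => [|y]; last by rewrite andbC.
by rewrite eulerian_kernel // addrC subrK.
Qed.

End Symmetry.

(** * The flag polynomial along an S-partition *)

Lemma coatom_own {disp : Order.disp_t} (T : finTPOrderType disp) (P : T -> {set T}) s :
  coatom_partition P -> s \in coatoms T -> s \in P s.
Proof.
move=> [sub _ /and3P[/eqP cov _ _]] sc.
have : s \in cover [set P s | s in coatoms T] by rewrite cov !inE coatom_neq_top.
move=> /bigcupP[B /imsetP[s' s'c ->] ss']; suff e : s = s' by rewrite {2}e.
have := subsetP (sub _ s'c) _ ss'; rewrite lower_closure1 le_eqVlt.
by case/orP => [/eqP//|/(coatom_max sc) e]; move: (coatom_neq_top s'c); rewrite e eqxx.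
Qed.

Section FacetParts.
Variables (K : nzRingType) (a b : K).
Context {disp : Order.disp_t} (T : finTPOrderType disp) (x0 : T).
Hypothesis min0 : forall x : T, (x0 <= x)%O.
Variable d : nat.
Hypothesis rT : poset_rank T = d.+2.

Let rank_coatom (s : T) : s \in coatoms T -> rank s = d.+1.
Proof. by rewrite inE rT => /eqP[]. Qed.

(** The chains with maximum in the class [A] of [s] but different from [s], as words
on the ranks [1, ..., d] below that of [s]. *)
Definition facet_part (A : {set T}) (s : T) : K :=
  \sum_(y in A :\ s) peak_poly a b y * (a - b) ^+ (d - rank y).

(** A chain ending in the class of [s] but not at [s] has [a - b] at the rank of the
facets, and the chains ending at [s] have [b] there; the two are rearranged
according to their last letter. *)
Lemma interval_poly_top_parts (P : T -> {set T}) : coatom_partition P ->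
  let X := \sum_(s in coatoms T) facet_part (P s) s in
  interval_poly a b (\top : T) =
    X * a + (\sum_(s in coatoms T) interval_poly a b s - X) * b.
Proof.
move=> part X; rewrite (interval_polyE _ _ min0) -/(poset_rank T) rT //=.
rewrite (eq_bigl (mem [set~ \top])) => [|y]; last first.
  by rewrite /= !inE lt_neqAle lex1 andbT.
rewrite (coatom_partition_sum _ part).
rewrite (eq_bigr (fun s => facet_part (P s) s * (a - b) + interval_poly a b s * b)).
  by rewrite big_split /= -!mulr_suml -/X mulrBr mulrBl addrAC addrA.
move=> s sc; rewrite (big_setD1 s) /=; last exact: coatom_own.
rewrite (rank_coatom sc) subnn expr0 mulr1 addrC; congr (_ + _).
  rewrite mulr_suml; apply: eq_bigr => y; rewrite in_setD1 => /andP[ys yP].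
  have /rank_lt : (y < s)%O.
    rewrite lt_neqAle ys -lower_closure1; have [sub _ _] := part.
    exact: (subsetP (sub s sc)).
  by rewrite (rank_coatom sc) ltnS => yd; rewrite subSn // exprSr mulrA.
by rewrite peak_polyE // (rank_coatom sc).
Qed.

Lemma initial_facet_part s : s \in coatoms T ->
  facet_part (lower_closure [set s]) s = interval_poly a b s.
Proof.
move=> sc; rewrite (interval_polyE _ _ min0) (rank_coatom sc) //=.
by apply: eq_bigl => y; rewrite in_setD1 lower_closure1 lt_neqAle.
Qed.

Lemma terminal_facet_part s : facet_part [set s] s = 0.
Proof. by rewrite /facet_part setDv big_set0. Qed.

Section Ordinary.
Variables (A : {set T}) (s : T).
Local Notation Gamma := (lower_closure (A :\ s)).
Local Notation L := (lower_poset Gamma).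
Local Notation S := (semisuspension L).
Hypotheses (gS : graded S) (rS : poset_rank S = d.+1) (d0 : (0 < d)%N).
Hypothesis poleC : (None : S) \in coatoms S.
Local Notation bdGamma := (lower_elements (boundary L)).
Hypotheses (GE : Gamma = (A :\ s) :|: bdGamma) (GD : [disjoint A :\ s & bdGamma]).

(* The faces of the class, seen in the semisuspension, form a lower set that [f]
identifies with a lower set of [T]. *)
Let f (x : S) : T := if x is Some (Some u) then val u else \top.
Let faces : {set S} := [set x : S | if x is Some (Some _) then true else false].

Let facesE (x : S) : (x \in faces) = (x != None) && (x != \top).
Proof. by rewrite inE; case: x => [[u|]|]. Qed.

Let low_faces (x y : S) : (x <= y)%O -> y \in faces -> x \in faces.
Proof. by rewrite !inE; case: x => [[x|]|]; case: y => [[y|]|]. Qed.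

Let emb : {in faces &, forall x y, (f x <= f y)%O = (x <= y)%O}.
Proof. by move=> x y; rewrite !inE; case: x => [[x|]|]; case: y => [[y|]|]. Qed.

Let sat : {in faces, forall x y, (y <= f x)%O -> exists2 z, z \in faces & f z = y}.
Proof.
move=> x; rewrite !inE; case: x => [[x|]|] //= _ y yx.
have yG : y \in Gamma by apply: lower_closure_down yx (valP x).
by exists (Some (Some (Sub y yG))); rewrite ?inE.
Qed.

Let rankf x : x \in faces -> rank (f x) = rank x.
Proof. exact: rank_lower_embedding. Qed.

Let peakf x : x \in faces -> peak_poly a b (f x) = peak_poly a b x.
Proof. exact: peak_poly_embedding. Qed.

Let sum_faces (B : pred S) (C : {set T}) (F : T -> K) :
    (forall u : subposet Gamma, B (Some (Some u)) = (val u \in C)) -> C \subset Gamma ->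
  \sum_(x in faces | B x) F (f x) = \sum_(y in C) F y.
Proof.
move=> BC CG; rewrite (eq_bigl (mem [set x in faces | B x])) => [|x]; last first.
  by rewrite /= !inE.
rewrite -(@big_imset _ _ _ _ _ f _ F) /=; last first.
  move=> x y; rewrite !inE => /andP[xF _] /andP[yF _] e; apply/le_anti.
  by rewrite -!emb ?inE // e lexx.
apply: eq_bigl => y; apply/imsetP/idP => [[x]|yC].
  by rewrite !inE; case: x => [[x|]|] //= xB ->; rewrite -BC.
exists (Some (Some (Sub y (subsetP CG _ yC)))) => //.
by rewrite !inE /= BC.
Qed.

(** The part of an ordinary facet through the semisuspension of its class: the
chains with maximum in the class are those of the ball that avoid the boundary,
and the boundary is the lower interval of the added coatom. *)
Lemma ordinary_facet_part :
  facet_part A s = interval_poly a b (\top : S) - interval_poly a b (None : S) * a.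
Proof.
have [[z0 minS] _] := gS.
have rkN : rank (None : S) = d by move: poleC; rewrite inE rS => /eqP[].
have bG : bdGamma \subset Gamma.
  apply/subsetP => y yb; move/setP/(_ y): GE => ->; by rewrite in_setU yb orbT.
have topE : interval_poly a b (\top : S) =
    interval_poly a b (None : S) * b +
    \sum_(y in Gamma) peak_poly a b y * (a - b) ^+ (d - rank y).
  rewrite (interval_polyE _ _ minS) -/(poset_rank S) rS //=.
  rewrite (bigD1 (None : S)) /=; last by rewrite lt_neqAle lex1.
  rewrite rkN subnn expr0 mulr1 peak_polyE ?rkN //; congr (_ + _).
  rewrite -(@sum_faces xpredT Gamma) //; last by move=> u; rewrite (valP u).
  apply: eq_big => [x|x]; first by rewrite andbT facesE lt_neqAle lex1 andbT andbC.
  rewrite lt_neqAle lex1 andbT => /andP[xt xN].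
  have xF : x \in faces by rewrite facesE xN.
  by rewrite peakf // rankf.
have boundE : \sum_(y in bdGamma) peak_poly a b y * (a - b) ^+ (d - rank y) =
    interval_poly a b (None : S) * (a - b).
  rewrite (interval_polyE _ _ minS) rkN // mulr_suml.
  rewrite -(@sum_faces (fun x => (x < None)%O) bdGamma) //; last first.
    move=> u; rewrite semisuspension_ltSN; apply/idP/lower_elementsP => [uB|[uG + _]].
      exists (valP u) => //; rewrite (_ : Sub _ _ = u) //; exact: val_inj.
    by rewrite (_ : Sub _ _ = u) //; apply: val_inj.
  apply: eq_big => [x|x].
    rewrite facesE; case: (boolP (x < None)%O) => xN; rewrite ?andbF // andbT.
    by rewrite (lt_eqF xN) (lt_top xN).
  move=> /andP[xF xN]; rewrite peakf // rankf // -mulrA -exprSr.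
  by congr (_ * _ ^+ _); have := rank_lt xN; rewrite rkN; case: (d) d0 => // m _ xm; rewrite subSn.
rewrite topE; rewrite mulrBr in boundE.
have := big_setID bdGamma (fun y => peak_poly a b y * (a - b) ^+ (d - rank y)) (A := Gamma).
rewrite (setIidPr bG) (_ : Gamma :\: _ = A :\ s) => [->|].
  by rewrite boundE addrA [_ * b + _]addrC subrK [RHS]addrC addKr.
apply/setP => y; rewrite in_setD; move/setP/(_ y): (GE) => ->; rewrite in_setU.
by have /= := pred0P GD y; case: (y \in A :\ s); case: (y \in bdGamma).
Qed.

End Ordinary.
End FacetParts.

(** * Non-negativity in a free ring *)

(** What is used of the free ring on the letters [L false] and [L true], with
constants [C] and coefficients [coef]: the words are independent, and multiplying
by a letter on the right appends it to them. *)
Record free_algebra (A : nzRingType) (L : bool -> A) (C : int -> A)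
    (coef : seq bool -> A -> int) : Prop := FreeAlgebra {
  const0 : C 0 = 0;
  coef_eq : forall p q, (forall w, coef w p = coef w q) -> p = q;
  coef_const : forall c w, coef w (C c) = if w is [::] then c else 0;
  coef_add : forall p q w, coef w (p + q) = coef w p + coef w q;
  coef_mul : forall p l w l',
    coef (rcons w l') (p * L l) = if l == l' then coef w p else 0;
  coef_mul_nil : forall p l, coef [::] (p * L l) = 0;
  last_letter : forall p, exists c p0 p1, p = C c + p0 * L false + p1 * L true;
  coef_bounded : forall p, exists n, forall w, (n <= size w)%N -> coef w p = 0
}.

Section FreeAlgebra.
Variables (A : nzRingType) (L : bool -> A) (C : int -> A) (coef : seq bool -> A -> int).
Hypothesis fA : free_algebra L C coef.
Implicit Types (p q : A) (w : seq bool) (l : bool).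

Lemma coef_letters c p q w l :
  coef (rcons w l) (C c + p * L false + q * L true) = coef w (if l then q else p).
Proof.
rewrite !(coef_add fA) !(coef_mul fA) (coef_const fA).
by case: l; case: w => [|? ?]; rewrite /= ?addr0 ?add0r.
Qed.

Lemma coef_letters_nil c p q : coef [::] (C c + p * L false + q * L true) = c.
Proof. by rewrite !(coef_add fA) !(coef_mul_nil fA) (coef_const fA) !addr0. Qed.

Lemma letters_free c c' p q p' q' :
    C c + p * L false + q * L true = C c' + p' * L false + q' * L true ->
  [/\ c = c', p = p' & q = q'].
Proof.
move=> e; split.
- by rewrite -(coef_letters_nil c p q) e coef_letters_nil.
- apply: (coef_eq fA) => w.
  by rewrite -(coef_letters c p q w false) e coef_letters.
- apply: (coef_eq fA) => w.
  by rewrite -(coef_letters c p q w true) e coef_letters.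
Qed.

Lemma letters_free0 p q p' q' :
    p * L false + q * L true = p' * L false + q' * L true ->
  p = p' /\ q = q'.
Proof.
by move=> e; case: (@letters_free 0 0 p q p' q'); rewrite ?(const0 fA) ?add0r.
Qed.

(** [c] for [false] and [d] for [true]. *)
Definition cd_letter l : A :=
  if l then L false * L true + L true * L false else L false + L true.

(** The words in [c] and [d] stay independent in the free ring on [a] and [b]:
comparing the words ending in [a] and those ending in [b] recovers the last
letter. *)
Lemma cd_substitution_inj (S : A -> A) :
    (forall p q, S (p + q) = S p + S q) -> (forall c, S (C c) = C c) ->
    (forall p l, S (p * L l) = S p * cd_letter l) ->
  forall p, S p = 0 -> p = 0.
Proof.
move=> SD SC SM p; have [n nP] := coef_bounded fA p.
have coef0 w : coef w 0 = 0 by rewrite -(const0 fA) (coef_const fA); case: w.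
elim: n p nP => [|n IH] p nP e; first by apply: (coef_eq fA) => w; rewrite nP ?coef0.
have [c [p0 [p1 pE]]] := last_letter fA p.
have cw w l : coef (rcons w l) p = coef w (if l then p1 else p0).
  by rewrite pE coef_letters.
move: e; rewrite pE !SD SC !SM /cd_letter !mulrDr !mulrA => e.
have [c0 e1 e2] : [/\ c = 0, S p0 + S p1 * L true = 0 & S p0 + S p1 * L false = 0].
  apply: letters_free; rewrite (const0 fA) !mul0r !addr0 -[RHS]e !mulrDl.
  by rewrite [LHS](AC (1*2*2) ((1*(2*4))*(5*3))).
have [z1 _] : S p1 = 0 /\ - S p1 = 0.
  apply: letters_free0; rewrite !mul0r addr0 mulNr.
  apply/eqP; rewrite subr_eq0; apply/eqP.
  by apply: (addrI (S p0)); rewrite e1 e2.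
have z0 : S p0 = 0 by move: e1; rewrite z1 mul0r addr0.
have -> : p0 = 0 by apply: IH z0 => w nw; rewrite -(cw w false) nP // size_rcons.
have -> : p1 = 0 by apply: IH z1 => w nw; rewrite -(cw w true) nP // size_rcons.
by rewrite c0 (const0 fA) !mul0r !addr0.
Qed.

End FreeAlgebra.

Section CdNonneg.
Context {disp : Order.disp_t}.
Variables (A : nzRingType) (L : bool -> A) (C : int -> A) (coef : seq bool -> A -> int).
Hypothesis fA : free_algebra L C coef.
Local Notation a := (L false).
Local Notation b := (L true).
Local Notation Psi := (interval_poly a b).
Local Notation cd_letter := (cd_letter L).

Lemma interval_poly_card2 (T : finTPOrderType disp) : #|T| = 2 -> Psi (\top : T) = 1.
Proof.
move=> T2; rewrite /interval_poly; suff : (rank (\top : T) <= 1)%N.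
  by case: (rank _) => [|[]].
have [B [_ sB <-]] := rank_witness (\top : T).
have : B \subset [set~ \top].
  by apply: subset_trans sB _; apply/subsetP => x; rewrite !inE lt_neqAle => /andP[].
by move/subset_leq_card; rewrite cardsC1 T2.
Qed.

(** The sum over the facets expresses the polynomial in [a] and [b] only.
Comparing it with the sum for the letters exchanged, which has the same value,
pairs each term with its mirror image. *)
Lemma interval_poly_facet_sum (T : finTPOrderType disp) (P : T -> {set T}) d :
    eulerian T -> poset_rank T = d.+2 -> coatom_partition P ->
  Psi (\top : T) = \sum_(s in coatoms T)
    (facet_part a b d (P s) s * a + facet_part b a d (P s) s * b).
Proof.
move=> eT rT part; have [[x0 min0] _] := proj1 eT.
have eab := interval_poly_top_parts a b min0 rT part.
have := interval_poly_top_parts b a min0 rT part.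
rewrite -(interval_poly_sym a b eT) /= eab /= [RHS]addrC.
move=> /(letters_free0 fA)[_ ->]; rewrite !mulr_suml -big_split /=.
by apply: eq_bigr.
Qed.

(** [N] stands for the cd-polynomials with non-negative coefficients, of which only
the closure properties matter. *)
Variable N : A -> Prop.
Hypotheses (N0 : N 0) (N1 : N 1) (ND : forall p q, N p -> N q -> N (p + q)).
Hypothesis NM : forall p l, N p -> N (p * cd_letter l).

(** The contribution of the initial facet is [c] times the polynomial of its
boundary. That of an ordinary facet is [(p - q c) c + q d], where [p] is the
polynomial of the semisuspension of its class and [q] that of the boundary of the
class; as the added coatom is initial in the semisuspension, [p - q c] is one of
the differences treated by the induction. *)
Lemma S_partition_cd_nonneg d (T : finTPOrderType disp) P (s1 : T) :
  is_S_partition d P s1 ->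
  N (Psi (\top : T) - Psi s1 * cd_letter false) /\ N (Psi s1).
Proof.
elim: d T P s1 => [//|d IH] T P s1 [[eT rT] part [[s1c Ps1] _] [rbd Sbd]].
move=> [st [[stc Pst] _] ord]; have [[x0 min0] _] := proj1 eT.
split; last first.
  pose bd := lower_poset (lower_closure [set s1] :\ s1).
  have -> : Psi s1 = Psi (\top : bd).
    rewrite -[s1]/(facet_boundary_val (\top : bd)).
    apply: (@interval_poly_embedding _ _ _ _ _ _ _ setT); rewrite ?inE //.
    - by move=> x y _ _; apply: facet_boundary_val_le.
    - by move=> x _ y /facet_boundary_val_sat[z fz]; exists z; rewrite ?inE.
  case: Sbd => [/interval_poly_card2->//|[Q [s /IH[n1 n2]]]].
  by have := ND n1 (NM false n2); rewrite subrK.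
rewrite (interval_poly_facet_sum eT rT part) (bigD1 s1) //= Ps1.
rewrite !(initial_facet_part _ _ min0 rT) // (interval_poly_sym b a eT).
rewrite -mulrDr -/(cd_letter false) addrAC subrr add0r.
apply: big_ind => // s /andP[sc ne]; have [->|nst] := eqVneq s st.
  by rewrite Pst !terminal_facet_part !mul0r addr0.
have [_ rL GE GD [Q SQ]] := ord s sc ne nst.
case: d => [|d] in rT rL rbd Sbd ord SQ IH *; first by case: SQ.
have [n1 n2] := IH _ _ _ SQ.
have [[eS rS] _ [[poleC _] _] _ _] := SQ.
rewrite !(ordinary_facet_part _ _ (proj1 eS) rS _ poleC GE GD) //.
rewrite -(interval_poly_sym a b eS) -(interval_poly_sym a b eS None).
set p := Psi _ in n1 n2 *; set q := Psi _ in n1 n2 *.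
have -> : (p - q * a) * a + (p - q * b) * b =
    (p - q * cd_letter false) * cd_letter false + q * cd_letter true.
  rewrite [X in _ = X + _]mulrBl; have -> : q * cd_letter false * cd_letter false =
      q * cd_letter true + (q * a * a + q * b * b).
    rewrite -[cd_letter true]/(a * b + b * a) -[cd_letter false]/(a + b).
    by rewrite !mulrDr !mulrDl !mulrA [LHS](AC (2*2) ((3*2)*(1*4))).
  rewrite opprD addrA addrAC subrK -[cd_letter false]/(a + b).
  by rewrite mulrDr !mulrBl opprD [LHS](AC (2*2) ((1*3)*(2*4))).
by apply: ND; apply: NM.
Qed.

End CdNonneg.

(** * The ab-index as a sum over chains *)

Section ChainSums.
Variables (A : nzRingType) (a b : A).
Context {disp : Order.disp_t}.

Section OnePoset.
Variable T : finTPOrderType disp.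
Implicit Types (C D : {set T}) (x y z : T).

Definition chain_weight n C : A :=
  \prod_(i < n) (if [exists x in C, rank x == i.+1] then b else a - b).

Definition ranked_chain n D C :=
  [&& chain C, C \subset D & [forall x in C, (0 < rank x <= n)%N]].

Lemma ranked_chainP n D C :
  reflect [/\ chain C, C \subset D & {in C, forall x, (0 < rank x <= n)%N}]
          (ranked_chain n D C).
Proof. by apply: (iffP and3P) => -[? ? /forall_inP]; split. Qed.

Lemma ranked_chain_top n D z C : z \in D -> rank z = n.+1 ->
  ranked_chain n.+1 D (z |: C) && ((z |: C) :\ z == C) =
  ranked_chain n (D :&: [set y | (y < z)%O]) C.
Proof.
move=> zD rz; apply/andP/ranked_chainP => [[/ranked_chainP[ch sub rk] /eqP e]|].
  have zC : z \notin C by rewrite -e !inE eqxx.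
  have lt y : y \in C -> (y < z)%O.
    move=> yC; have yU : y \in z |: C by rewrite setU1r.
    have yz : y != z by apply: contraNneq zC => <-.
    have /chainP/(_ y z yU (setU11 _ _)) := ch.
    rewrite /Order.comparable !le_eqVlt (negPf yz) eq_sym (negPf yz) => /orP[//|/rank_lt].
    by have /andP[_] := rk y yU; rewrite rz ltnNge => ->.
  split; first by apply: chain_sub ch; apply: subsetUr.
    rewrite subsetI (subset_trans (subsetUr _ _) sub) /=.
    by apply/subsetP => y /lt; rewrite inE.
  move=> y yC; have /andP[-> _] := rk y (setU1r z yC).
  by have := rank_lt (lt y yC); rewrite rz ltnS.
move=> [ch]; rewrite subsetI => /andP[sub lt] rk.
have zC : z \notin C by apply/negP => /(subsetP lt); rewrite inE ltxx.
split; last by rewrite setU1K.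
apply/ranked_chainP; split; first exact: chain_add.
  by rewrite subUset sub1set zD.
by move=> y /setU1P[->|/rk/andP[-> /leqW]]; rewrite ?rz ?leqnn.
Qed.

Lemma chain_weightS n z C : rank z = n.+1 -> {in C, forall x, (rank x <= n)%N} ->
  chain_weight n.+1 (z |: C) = chain_weight n C * b.
Proof.
move=> rz rk; rewrite /chain_weight big_ord_recr /=; congr (_ * _).
  apply: eq_bigr => i _; congr (if _ then _ else _).
  apply/exists_inP/exists_inP => -[x xC rx]; exists x => //; last exact: setU1r.
  by case/setU1P: xC rx => [->|//]; rewrite rz eqSS gtn_eqF.
by case: exists_inP => // -[]; exists z; rewrite ?setU11 ?rz.
Qed.

(** In the recursion on the last letter, the chains with an element [z] of the
highest rank correspond to the chains strictly below [z]. *)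
Lemma chain_sum n D :
  \sum_(C : {set T} | ranked_chain n D C) chain_weight n C = flag_poly a b n D.
Proof.
elim: n D => [|n IH] D /=.
  rewrite (big_pred1 set0) => [|C]; first by rewrite /chain_weight big_ord0.
  apply/ranked_chainP/eqP => [[_ _ rk]|->].
    apply/setP => x; rewrite inE; apply/negP => /rk.
    by rewrite leqn0; case: (rank x).
  by split=> [||x]; rewrite ?sub0set ?inE //; apply/chainP => x y; rewrite inE.
rewrite (bigID (fun C => [exists x in C, rank x == n.+1])) /= addrC.
congr (_ + _).
  rewrite -IH mulr_suml; apply: eq_big => C.
    apply/andP/ranked_chainP => [[/ranked_chainP[ch sub rk] /exists_inPn nx]|[ch sub rk]].
      split=> // x xC; have /andP[-> rx] := rk x xC.
      by rewrite -ltnS ltn_neqAle rx nx.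
    split; first by apply/ranked_chainP; split=> // x /rk/andP[-> /leqW].
    by apply/exists_inPn => x /rk/andP[_ rx]; rewrite neq_ltn ltnS rx.
  move=> /andP[_ nx]; rewrite /chain_weight big_ord_recr /= (negPf nx) //.
transitivity (\sum_(C : {set T} | ranked_chain n.+1 D C)
    \sum_(z in D | (z \in C) && (rank z == n.+1)) chain_weight n.+1 C).
  rewrite big_mkcondr; apply: eq_bigr => C /ranked_chainP[ch sub rk].
  case: ifPn => [/exists_inP[z zC /eqP rz]|/exists_inPn nx]; last first.
    by rewrite big1 // => z /and3P[_ /nx/negPf->].
  rewrite (big_pred1 z) // => w; apply/and3P/eqP => [[_ wC /eqP rw]|->]; last first.
    by rewrite (subsetP sub) // zC rz.
  have /chainP/(_ w z wC zC) := ch; rewrite /Order.comparable !le_eqVlt.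
  case: eqVneq => [->//|wz] /=.
  by case/orP => /rank_lt; rewrite rw rz ltnn.
rewrite (exchange_big_dep (fun z => (z \in D) && (rank z == n.+1))) /=; last first.
  by move=> C z _ /and3P[-> _ ->].
apply: eq_bigr => z /andP[zD /eqP rz]; rewrite -IH mulr_suml.
rewrite (reindex_onto (fun C => z |: C) (fun C => C :\ z)) /=; last first.
  by move=> C /andP[_ /and3P[_ zC _]]; rewrite setD1K.
apply: eq_big => [C|C].
  by rewrite setU11 zD rz eqxx /= andbT ranked_chain_top.
rewrite setU11 zD rz eqxx /= andbT ranked_chain_top // => /ranked_chainP[_ _ rk].
by rewrite chain_weightS // => x /rk/andP[].
Qed.

End OnePoset.

Section Expansion.
Variable d : nat.
Implicit Types K L : {set 'I_d}.

Definition ab_word K : A := \prod_(i < d) (if i \in K then b else a).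

Lemma prod_mulrz (I : finType) (x : I -> A) (s : I -> int) :
  \prod_i (x i *~ s i) = (\prod_i x i) *~ \prod_i s i.
Proof.
apply: (big_rec3 (fun u v w => u = v *~ w)) => // i u v w _ ->.
by rewrite mulrzAr mulrzAl -mulrzA mulrC.
Qed.

(** Expanding the differences [a - b]: the set [K] collects the ranks at which [b] is
chosen, with a sign at those outside [L]. This is the passage from [f] to [h]. *)
Lemma expand_word L :
  \prod_(i < d) (if i \in L then b else a - b) =
    \sum_(K : {set 'I_d} | L \subset K) ab_word K *~ (-1) ^+ #|K :\: L|.
Proof.
pose F (i : 'I_d) : A := if i \in L then b else - b.
pose G (i : 'I_d) : A := if i \in L then 0 else a.
rewrite (eq_bigr (fun i => F i + G i)) => [|i _]; last first.
  by rewrite /F /G; case: ifP; rewrite ?addr0 // addrC.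
rewrite bigA_distr [RHS]big_mkcond; apply: eq_bigr => K _ /=; case: ifPn => [LK|].
  rewrite /ab_word -prodr_const [X in _ *~ X]big_mkcond /= -prod_mulrz.
  apply: eq_bigr => i _; rewrite /F /G inE.
  case: (boolP (i \in L)) => iL /=; first by rewrite (subsetP LK).
  by case: (i \in K); rewrite ?mulrNz.
case/subsetPn => i iL iK; have := mem_index_enum i.
elim: (index_enum _) => [//|j r IH]; rewrite inE big_cons => /orP[/eqP<-|/IH->].
  by rewrite (negPf iK) /G iL mul0r.
by rewrite mulr0.
Qed.

End Expansion.

Lemma flag_sum (T : finTPOrderType disp) :
  \sum_(K : {set 'I_(poset_rank T).-1}) ab_word K *~ flag_h K =
    interval_poly a b (\top : T).
Proof.
set d := (poset_rank T).-1.
rewrite /interval_poly -chain_sum -/(poset_rank T) -/d.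
transitivity (\sum_(L : {set 'I_d})
    (\prod_(i < d) (if i \in L then b else a - b)) *+ @flag_f _ T L).
  under eq_bigr => K _ do rewrite /flag_h mulrz_sumr.
  rewrite (exchange_big_dep xpredT) //=; apply: eq_bigr => L _.
  rewrite expand_word -sumrMnl; apply: eq_bigr => K _.
  by rewrite mulrzA.
under eq_bigr => L _ do rewrite -sumr_const.
rewrite (exchange_big_dep (ranked_chain d [set y | (y < \top)%O])) /=.
  apply: eq_bigr => C /ranked_chainP[ch sub rk].
  rewrite (big_pred1 [set i : 'I_d | [exists x in C, rank x == i.+1]]).
    by apply: eq_bigr => i _; rewrite inE.
  move=> L; rewrite inE ch /=; apply/andP/eqP => [[/forall_inP h1 /forall_inP h2]|->].
    apply/setP => i; rewrite inE; apply/idP/exists_inP => [/h2/exists_inP//|[x xC /eqP rx]].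
    have /exists_inP[j jL] := h1 x xC; rewrite rx eqSS => /eqP/val_inj->; exact: jL.
  split; apply/forall_inP => [x xC]; last by move: xC; rewrite inE.
  have /andP[r0 rd] := rk x xC; have ri : ((rank x).-1 < d)%N by rewrite prednK.
  apply/exists_inP; exists (Ordinal ri); last by rewrite /= prednK.
  by rewrite inE; apply/exists_inP; exists x; rewrite //= prednK.
move=> L C _; rewrite inE => /and3P[ch /forall_inP h1 _].
have rk x : x \in C -> (0 < rank x <= d)%N.
  by move=> /h1/exists_inP[i _ /eqP->]; rewrite ltn_ord.
apply/ranked_chainP; split=> //; apply/subsetP => x xC; rewrite inE lt_neqAle lex1 andbT.
apply/eqP => xt; have := rk x xC; rewrite xt -/(poset_rank T) /d.
by case: (poset_rank T) => //= m; rewrite ltnn.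
Qed.

End ChainSums.

(** * The ab-polynomials as a free ring, and the theorem *)

Section AbPolynomials.
Implicit Types (p q : ab_poly) (w : seq bool) (l : bool).

Definition letter l : ab_poly := << fmu l >>.

Definition word_coef w p : int := p@_(FMonom w).

Lemma malg_ind (Pr : ab_poly -> Prop) :
    Pr 0 -> (forall p q, Pr p -> Pr q -> Pr (p + q)) ->
    (forall (c : int) w, Pr << c *g FMonom w >>) ->
  forall p, Pr p.
Proof. by move=> P0 PD PU p; rewrite (monalgE p); elim/big_ind: _ => // -[w] _. Qed.

Lemma mul_letter (c : int) w l :
  << c *g FMonom w >> * letter l = << c *g FMonom (rcons w l) >> :> ab_poly.
Proof.
rewrite malgM_def fgmulUU mulr1; congr << c *g _ >>.
by apply/val_inj; rewrite /= fmM fmU cats1.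
Qed.

Lemma regroup (A : nzRingType) (x y u v p0 q0 p1 q1 : A) :
  (x + p0 * u + p1 * v) + (y + q0 * u + q1 * v) =
  (x + y) + (p0 + q0) * u + (p1 + q1) * v.
Proof. by rewrite !mulrDl (AC (3*3) ((1*4)*(2*5)*(3*6))). Qed.

Lemma word_coefD p q w : word_coef w (p + q) = word_coef w p + word_coef w q.
Proof. exact: mcoeffD. Qed.

Lemma word_coef_mul p l w l' :
  word_coef (rcons w l') (p * letter l) = if l == l' then word_coef w p else 0.
Proof.
elim/malg_ind: p => [|p q IHp IHq|c w'].
- by rewrite mul0r /word_coef !mcoeff0; case: ifP.
- apply: etrans (congr1 _ (mulrDl _ _ _)) _.
  apply: etrans (word_coefD _ _ _) (etrans (congr2 +%R IHp IHq) _).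
  by rewrite word_coefD; case: ifP => // _; rewrite addr0.
rewrite mul_letter /word_coef !mcoeffU -!val_eqE /= eqseq_rcons.
by case: (w' == w); case: (l == l').
Qed.

Lemma word_coef_mul_nil p l : word_coef [::] (p * letter l) = 0.
Proof.
elim/malg_ind: p => [|p q IHp IHq|c w']; first by rewrite mul0r /word_coef mcoeff0.
  apply: etrans (congr1 _ (mulrDl _ _ _)) _.
  exact: etrans (word_coefD _ _ _) (etrans (congr2 +%R IHp IHq) (addr0 _)).
by rewrite mul_letter /word_coef mcoeffU -val_eqE /=; case: w'.
Qed.

Lemma ab_poly_last_letter p :
  exists (c : int) p0 p1, p = c%:MP + p0 * letter false + p1 * letter true.
Proof.
elim/malg_ind: p => [|p q [c [p0 [p1 ->]]] [c' [q0 [q1 ->]]]|c w].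
- by exists 0, 0, 0; rewrite !mul0r !addr0 malgC0E.
- exists (c + c'), (p0 + q0), (p1 + q1).
  apply: etrans (regroup _ _ _ _ _ _ _ _) _.
  exact: (congr1 (fun x => x + _ + _) (esym (monalgUD _ c c'))).
case: (lastP w) => [|w' l].
  exists c, 0, 0; rewrite !mul0r !addr0; congr << c *g _ >>.
  by apply: val_inj; rewrite /= fm1.
case: l; [exists 0, 0, << c *g FMonom w' >>|exists 0, << c *g FMonom w' >>, 0];
  by rewrite mul0r mul_letter malgC0E ?addr0 add0r.
Qed.

Lemma ab_poly_free : free_algebra letter (fun c : int => c%:MP) word_coef.
Proof.
split.
- exact: malgC0E.
- by move=> p q e; apply/malgP => -[w]; apply: e.
- move=> c w; rewrite /word_coef mcoeffC -val_eqE /= fm1.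
  by case: w.
- exact: word_coefD.
- exact: word_coef_mul.
- exact: word_coef_mul_nil.
- exact: ab_poly_last_letter.
move=> p; exists (\max_(k <- msupp p) (size (k : seq bool)).+1)%N => w nw.
apply: mcoeff_outdom; apply: contraTN nw => wp; rewrite -ltnNge.
by rewrite (big_fsetD1 _ wp) leq_max leqnn.
Qed.

Lemma cd_substD p q : cd_subst (p + q) = cd_subst p + cd_subst q.
Proof. exact: mmapD. Qed.

Lemma cd_substC (c : int) : cd_subst c%:MP = c%:MP.
Proof. by rewrite /cd_subst mmapU fm1 big_nil mulr1. Qed.

Lemma cd_subst_mul p l : cd_subst (p * letter l) = cd_subst p * cd_letter letter l.
Proof.
elim/malg_ind: p => [|p q IHp IHq|c w].
- by rewrite mul0r -malgC0E cd_substC malgC0E mul0r.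
- apply: etrans (congr1 _ (mulrDl _ _ _)) _.
  apply: etrans (cd_substD _ _) (etrans (congr2 +%R IHp IHq) _).
  exact: etrans (esym (mulrDl _ _ _)) (congr1 (fun x => x * _) (esym (cd_substD _ _))).
rewrite mul_letter /cd_subst [LHS]mmapU [X in _ = X * _]mmapU /= -cats1 big_cat big_seq1.
by rewrite mulrA.
Qed.

Lemma cd_subst_inj : injective cd_subst.
Proof.
move=> p q e; apply/eqP; rewrite -subr_eq0; apply/eqP.
apply: (cd_substitution_inj ab_poly_free cd_substD cd_substC cd_subst_mul).
by rewrite /cd_subst mmapB -!/(cd_subst _) e subrr.
Qed.

Definition cd_nonneg (p : ab_poly) : Prop :=
  exists Phi : cd_poly, (forall w : {fmonom bool}, 0 <= Phi@_w) /\ cd_subst Phi = p.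

Lemma cd_nonneg0 : cd_nonneg 0.
Proof.
exists 0; split=> [w|]; first by rewrite mcoeff0.
by rewrite -malgC0E cd_substC.
Qed.

Lemma cd_nonneg1 : cd_nonneg 1.
Proof.
exists 1; split; last exact: cd_substC.
by move=> w; rewrite mcoeff1; case: eqP.
Qed.

Lemma cd_nonnegD p q : cd_nonneg p -> cd_nonneg q -> cd_nonneg (p + q).
Proof.
move=> [P [P0 <-]] [Q [Q0 <-]]; exists (P + Q); split; last exact: cd_substD.
by move=> w; rewrite mcoeffD addr_ge0.
Qed.

Lemma cd_nonneg_mul p l : cd_nonneg p -> cd_nonneg (p * cd_letter letter l).
Proof.
move=> [P [P0 <-]]; exists (P * letter l); split; last exact: cd_subst_mul.
move=> [w]; rewrite -/(word_coef w _); case: (lastP w) => [|w' l'].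
  by rewrite word_coef_mul_nil.
by rewrite word_coef_mul; case: ifP => // _; apply: P0.
Qed.

End AbPolynomials.

Lemma ab_indexE {disp : Order.disp_t} (T : finTPOrderType disp) :
  ab_index T = interval_poly (letter false) (letter true) (\top : T).
Proof.
rewrite -flag_sum; apply: eq_bigr => K _.
by rewrite -scaler_int intz.
Qed.

Theorem S_partitionable_cd_index {disp : Order.disp_t} (T : finTPOrderType disp) :
    S_partitionable T ->
  exists Phi : cd_poly, is_cd_index T Phi /\ (forall w : {fmonom bool}, 0 <= Phi@_w).
Proof.
move=> pT; suff [Phi [pos e]] : cd_nonneg (ab_index T).
  by exists Phi; split=> //; split=> // Phi' e'; apply: cd_subst_inj; rewrite e e'.
rewrite ab_indexE; case: pT => [/interval_poly_card2->|[P [s sP]]].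
  exact: cd_nonneg1.
have [N1 N2] := S_partition_cd_nonneg ab_poly_free cd_nonneg0 cd_nonneg1 cd_nonnegD
  cd_nonneg_mul sP.
by have := cd_nonnegD N1 (cd_nonneg_mul false N2); rewrite subrK.
Qed.

Theorem corollary3p11 (V : finType) (Delta : {set {set V}})
    (Delta_complex : simplicial_complex Delta)
    (Delta_partitionable : partitionable Delta)
    (Delta_eulerian : eulerian (face_poset Delta)) :
  S_partitionable (face_poset Delta) /\
  exists Phi : cd_poly,
    is_cd_index (face_poset Delta) Phi /\
    (forall w : {fmonom bool}, 0 <= Phi@_w).
Proof.
have SD := partitionable_S_partitionable Delta_complex Delta_partitionable Delta_eulerian.
by split; last exact: S_partitionable_cd_index.
Qed.
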